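(* Let $K$ be a commutative noetherian complete semilocal ring in which $2$ is invertible, let $\mathscr{C}$ be a $K$-category equipped with a nonempty family of $K$-linear hermitian structures $\{( *_i,\omega_i)\}_{i\in I}$, and let $(M,\{s_i\})$, $(M',\{s'_i\})$, $(M'',\{s''_i\})$ be systems of sesquilinear forms over $(\mathscr{C},\{*_i,\omega_i\}_{i\in I})$. Assume that $\mathrm{Hom}_{\mathscr{C}}(X,Y)$ is finitely generated as a $K$-module for all $X,Y\in\mathscr{C}$. Then $$(M,\{s_i\})\oplus(M',\{s'_i\})\simeq(M,\{s_i\})\oplus(M'',\{s''_i\})\iff(M',\{s'_i\})\simeq(M'',\{s''_i\}),$$ where $\simeq$ denotes isometry and $\oplus$ orthogonal sum.
   Context: A ring $E$ is semilocal if $E/\mathrm{Jac}(E)$ is semisimple; it is complete semilocal if moreover the natural map $E\to\varprojlim_n E/\mathrm{Jac}(E)^n$ is an isomorphism. A $K$-category is an additive category whose Hom-sets are $K$-modules with $K$-bilinear composition. A hermitian structure on an additive category $\mathscr{C}$ is a pair $( *,\omega)$ with $*:\mathscr{C}\to\mathscr{C}$ an (additive) contravariant functor and $\omega:\mathrm{id}\to **$ a natural transformation (not necessarily an isomorphism) with $\omega_C^*\,\omega_{C^*}=\mathrm{id}_{C^*}$ for all $C$; it is $K$-linear if $*$ is $K$-linear on Hom-modules. A system of sesquilinear forms over $(\mathscr{C},\{*_i,\omega_i\}_{i\in I})$ is a pair $(M,\{s_i\}_{i\in I})$ with $M\in\mathscr{C}$ and $s_i:M\to M^{*_i}$ any morphism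 for each $i$. An isometry $(M,\{s_i\})\to(M',\{s_i'\})$ is an isomorphism $f:M\to M'$ with $f^{*_i}s_i'f=s_i$ for all $i\in I$. The orthogonal sum is $(M\oplus M',\{s_i\oplus s'_i\})$. *)

(* Defs.v *)
From HB Require Import structures.
From mathcomp Require Import all_boot all_algebra.
From mathcomp Require Import boolp classical_sets functions.

Set Implicit Arguments.
Unset Strict Implicit.
Unset Printing Implicit Defensive.

Import GRing.Theory.

Local Open Scope classical_set_scope.
Local Open Scope ring_scope.

Section Ideals.
Variable E : pzRingType.
Implicit Types I J : set E.

Definition left_ideal I : Prop :=
  [/\ I 0, (forall x y, I x -> I y -> I (x + y)) &
      forall a x, I x -> I (a * x)].

Definition maximal_left_ideal I : Prop :=
  [/\ left_ideal I, ~ I 1 &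
      forall J, left_ideal J -> ~ J 1 -> I `<=` J -> J = I].

Definition Jac : set E := [set x | forall I, maximal_left_ideal I -> I x].

Definition ideal_mul I J : set E :=
  [set x | exists s : seq (E * E),
     (forall p, p \in s -> I p.1 /\ J p.2) /\ x = \sum_(p <- s) p.1 * p.2].

Fixpoint ideal_exp I n : set E :=
  if n is m.+1 then ideal_mul I (ideal_exp I m) else setT.

Definition adic_coset I n (x : E) : set E := [set y | ideal_exp I n (y - x)].

(* An element of lim_n E / I^n is a family of cosets of the I^n; since I^(n+1)
   is contained in I^n, the projection E / I^(n+1) -> E / I^n sends a coset to
   the unique coset of I^n that contains it. *)
Definition adic_limit I : set (nat -> set E) :=
  [set c | (forall n, exists x, c n = adic_coset I n x) /\
           (forall n, c n.+1 `<=` c n)].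

Definition adically_complete I : Prop :=
  set_bij setT (adic_limit I) (fun x n => adic_coset I n x).

End Ideals.

Arguments Jac E : clear implicits.

(* Semisimple as a left module over itself: every submodule is a direct
   summand. *)
Definition semisimple_ring (S : pzRingType) : Prop :=
  forall L : set S, left_ideal L ->
    exists L' : set S, [/\ left_ideal L', L `&` L' = [set 0] &
      forall x, exists y z, [/\ L y, L' z & x = y + z]].

(* The quotient ring E / Jac(E) is presented by a surjective ring morphism out
   of E with kernel Jac(E). *)
Definition semilocal (E : pzRingType) : Prop :=
  exists (S : pzRingType) (pi : {rmorphism E -> S}),
    [/\ (forall y, exists x, pi x = y),
        (forall x, pi x = 0 <-> Jac E x) & semisimple_ring S].

Definition complete_semilocal (E : pzRingType) : Prop :=
  semilocal E /\ adically_complete (Jac E).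

Definition finitely_generated (K : pzRingType) (V : lmodType K) (A : set V) :
    Prop :=
  exists s : seq V,
    A = [set v | exists c : 'I_(size s) -> K, v = \sum_(i < size s) c i *: s`_i].

Definition noetherian (K : comPzRingType) : Prop :=
  forall I : set K, left_ideal I -> finitely_generated (I : set K^o).

Record kcategory (K : comPzRingType) : Type := KCategory {
  kob :> Type;
  khom : kob -> kob -> lmodType K;
  kid : forall X, khom X X;
  kcomp : forall X Y Z, khom Y Z -> khom X Y -> khom X Z;
  kcomp_idl : forall X Y (f : khom X Y), kcomp (kid Y) f = f;
  kcomp_idr : forall X Y (f : khom X Y), kcomp f (kid X) = f;
  kcompA : forall X Y Z T (h : khom Z T) (g : khom Y Z) (f : khom X Y),
    kcomp h (kcomp g f) = kcomp (kcomp h g) f;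
  kcomp_linearl : forall X Y Z (f : khom X Y),
    linear (fun g : khom Y Z => kcomp g f);
  kcomp_linearr : forall X Y Z (g : khom Y Z),
    linear (fun f : khom X Y => kcomp g f);
  kzero : kob;
  kzero_initial : forall X (f : khom kzero X), f = 0;
  kzero_terminal : forall X (f : khom X kzero), f = 0;
  ksum : kob -> kob -> kob;
  kin1 : forall X Y, khom X (ksum X Y);
  kin2 : forall X Y, khom Y (ksum X Y);
  kpr1 : forall X Y, khom (ksum X Y) X;
  kpr2 : forall X Y, khom (ksum X Y) Y;
  kpr1_in1 : forall X Y, kcomp (kpr1 X Y) (kin1 X Y) = kid X;
  kpr2_in2 : forall X Y, kcomp (kpr2 X Y) (kin2 X Y) = kid Y;
  kpr1_in2 : forall X Y, kcomp (kpr1 X Y) (kin2 X Y) = 0;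
  kpr2_in1 : forall X Y, kcomp (kpr2 X Y) (kin1 X Y) = 0;
  ksum_id : forall X Y,
    kcomp (kin1 X Y) (kpr1 X Y) + kcomp (kin2 X Y) (kpr2 X Y) = kid (ksum X Y)
}.

Arguments khom {K C} X Y : rename.
Arguments kid {K C} X : rename.
Arguments kcomp {K C X Y Z} g f : rename.
Arguments ksum {K C} X Y : rename.
Arguments kin1 {K C} X Y : rename.
Arguments kin2 {K C} X Y : rename.
Arguments kpr1 {K C} X Y : rename.
Arguments kpr2 {K C} X Y : rename.

Definition kiso (K : comPzRingType) (C : kcategory K) (X Y : C)
    (f : khom X Y) : Prop :=
  exists g : khom Y X, kcomp g f = kid X /\ kcomp f g = kid Y.

Definition ksum_map (K : comPzRingType) (C : kcategory K) (X X' Y Y' : C)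
    (f : khom X Y) (f' : khom X' Y') : khom (ksum X X') (ksum Y Y') :=
  kcomp (kin1 Y Y') (kcomp f (kpr1 X X')) +
  kcomp (kin2 Y Y') (kcomp f' (kpr2 X X')).

Record hermitian_structure (K : comPzRingType) (C : kcategory K) : Type :=
  HermitianStructure {
  hdual : C -> C;
  hdualm : forall X Y : C, khom X Y -> khom (hdual Y) (hdual X);
  hdualm_id : forall X : C, hdualm (kid X) = kid (hdual X);
  hdualm_comp : forall (X Y Z : C) (g : khom Y Z) (f : khom X Y),
    hdualm (kcomp g f) = kcomp (hdualm f) (hdualm g);
  hdualm_add : forall (X Y : C) (f g : khom X Y),
    hdualm (f + g) = hdualm f + hdualm g;
  homega : forall X : C, khom X (hdual (hdual X));
  homega_natural : forall (X Y : C) (f : khom X Y),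
    kcomp (homega Y) f = kcomp (hdualm (hdualm f)) (homega X);
  hdualm_homega : forall X : C,
    kcomp (hdualm (homega X)) (homega (hdual X)) = kid (hdual X)
}.

Arguments hdual {K C} h X : rename.
Arguments hdualm {K C} h {X Y} f : rename.
Arguments homega {K C} h X : rename.

Definition klinear_structure (K : comPzRingType) (C : kcategory K)
    (h : hermitian_structure C) : Prop :=
  forall X Y : C, linear (fun f : khom X Y => hdualm h f).

(* The canonical isomorphism X^* (+) Y^* -> (X (+) Y)^*, inverse to the
   morphism with components kin1^* and kin2^*. *)
Definition hdual_ksum (K : comPzRingType) (C : kcategory K)
    (h : hermitian_structure C) (X Y : C) :
    khom (ksum (hdual h X) (hdual h Y)) (hdual h (ksum X Y)) :=
  kcomp (hdualm h (kpr1 X Y)) (kpr1 (hdual h X) (hdual h Y)) +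
  kcomp (hdualm h (kpr2 X Y)) (kpr2 (hdual h X) (hdual h Y)).

Record sesq_system (K : comPzRingType) (C : kcategory K) (I : Type)
    (H : I -> hermitian_structure C) : Type := SesqSystem {
  sys_ob : C;
  sys_form : forall i, khom sys_ob (hdual (H i) sys_ob)
}.

Definition isometric (K : comPzRingType) (C : kcategory K) (I : Type)
    (H : I -> hermitian_structure C) (S S' : sesq_system H) : Prop :=
  exists f : khom (sys_ob S) (sys_ob S'),
    kiso f /\
    forall i, kcomp (hdualm (H i) f) (kcomp (sys_form S' i) f) = sys_form S i.

Definition orth_sum (K : comPzRingType) (C : kcategory K) (I : Type)
    (H : I -> hermitian_structure C) (S S' : sesq_system H) : sesq_system H :=
  {| sys_ob := ksum (sys_ob S) (sys_ob S');
     sys_form := fun i => kcomp (hdual_ksum (H i) (sys_ob S) (sys_ob S'))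
                            (ksum_map (sys_form S i) (sys_form S' i)) |}.

(* Main.v *)
Require Import Defs.
From HB Require Import structures.
From mathcomp Require Import all_boot all_algebra.
From mathcomp Require Import boolp classical_sets functions.

(** Pairs (u, v) of mutually adjoint endomorphisms of the system S = (M + M')
    + (M + M'') form a finitely generated K-algebra R with the involution that
    swaps u and v, and isometries between orthogonal summands of S are partial
    isometries of R. This turns the theorem into a cancellation statement for
    projections e1, e1', e2, e2' of R.

    Isometries e1 -> e2 and e1 + e1' -> e2 + e2' yield an isotropic unimodular
    vector w = (p, q, m) in the orthogonal sum of the hyperbolic plane over R
    and e1' R, together with an isometric copy of e2' in its orthogonal
    complement. If p is a unit, projecting this copy along w embeds e2' into
    e1'. To make p a unit, move w by Eichler transformations and by partial
    swaps of the hyperbolic plane so that the annihilator of p modulo the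
    radical is minimal; the swaps exist because R modulo its radical is von
    Neumann regular and symmetric elements lift to symmetric elements with
    symmetric quasi-inverses by Newton's iteration, which converges as K is
    complete. The two embeddings e2' -> e1' and e1' -> e2' are isometries
    since R is Dedekind finite. *)

Set Implicit Arguments.
Unset Strict Implicit.
Unset Printing Implicit Defensive.

Import GRing.Theory.

Local Open Scope classical_set_scope.
Local Open Scope ring_scope.

(** * Reflective decision procedure for identities in abelian groups *)

Section AdditiveExpressions.

Inductive addexp : Type :=
  AddVar of nat | AddZero | AddPlus of addexp & addexp | AddOpp of addexp.

Fixpoint addexp_coef (e : addexp) (i : nat) : int :=
  match e with
  | AddVar j => (i == j)%:Z
  | AddZero => 0
  | AddPlus e1 e2 => addexp_coef e1 i + addexp_coef e2 i
  | AddOpp e1 => - addexp_coef e1 i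
  end.

Variable V : zmodType.

Fixpoint addexp_eval (env : seq V) (e : addexp) : V :=
  match e with
  | AddVar j => env`_j
  | AddZero => 0
  | AddPlus e1 e2 => addexp_eval env e1 + addexp_eval env e2
  | AddOpp e1 => - addexp_eval env e1
  end.

Lemma addexp_evalE env e :
  addexp_eval env e = \sum_(i < size env) env`_i *~ addexp_coef e i.
Proof.
elim: e => [j||e1 IH1 e2 IH2|e1 IH1] /=.
- case: (ltnP j (size env)) => hj; last first.
    rewrite nth_default // big1 // => i _.
    by rewrite ltn_eqF ?mulr0z // (leq_trans _ hj).
  rewrite (bigD1 (Ordinal hj)) //= eqxx mulr1z big1 ?addr0 // => i ne.
  suff -> : (val i == j) = false by rewrite mulr0z.
  by apply: contraNF ne => /eqP eij; apply/eqP/val_inj.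
- by rewrite big1 // => i _; rewrite mulr0z.
- by rewrite IH1 IH2 -big_split /=; apply: eq_bigr => i _; rewrite mulrzDr.
- by rewrite IH1 -sumrN; apply: eq_bigr => i _; rewrite mulrNz.
Qed.

(** The integer coefficients determine the value, and the hypothesis is a closed computation, so
    [abel] discharges it with [isT]. *)
Lemma addexp_eq env e1 e2 :
  all (fun i => addexp_coef e1 i == addexp_coef e2 i) (iota 0 (size env)) ->
  addexp_eval env e1 = addexp_eval env e2.
Proof.
move=> /allP h; rewrite !addexp_evalE; apply: eq_bigr => i _.
by rewrite (eqP (h i _)) // mem_iota ltn_ord.
Qed.

End AdditiveExpressions.

(* Atoms are compared up to conversion, since the same operation may be reached
   along different paths of the algebraic hierarchy. *)
Ltac env_index x l :=
  lazymatch l with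
  | ?y :: ?l1 =>
    match goal with
    | _ => let u := match goal with _ => unify x y end in constr:(0%N)
    | _ => let n := env_index x l1 in constr:(S n)
    end
  end.

Ltac env_insert x l :=
  match goal with
  | _ => let n := env_index x l in l
  | _ => constr:(x :: l)
  end.

Ltac env_collect e l :=
  lazymatch e with
  | @GRing.add _ ?a ?b => let l1 := env_collect a l in env_collect b l1
  | @GRing.opp _ ?a => env_collect a l
  | @GRing.zero _ => l
  | _ => env_insert e l
  end.

Ltac addexp_reify e l :=
  lazymatch e with
  | @GRing.add _ ?a ?b =>
      let a1 := addexp_reify a l in
      let b1 := addexp_reify b l in constr:(AddPlus a1 b1)
  | @GRing.opp _ ?a => let a1 := addexp_reify a l in constr:(AddOpp a1)
  | @GRing.zero _ => constr:(AddZero)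
  | _ => let n := env_index e l in constr:(AddVar n)
  end.

Ltac abel :=
  lazymatch goal with
  | |- @eq ?T ?a ?b =>
    let l0 := env_collect a (@nil T) in
    let l := env_collect b l0 in
    let ea := addexp_reify a l in
    let eb := addexp_reify b l in
    exact: (@addexp_eq _ l ea eb isT)
  end.

Ltac expand :=
  rewrite ?(mulrDl, mulrDr, mulrN, mulNr, mulrA, mul1r, mulr1, mul0r, mulr0,
            opprD, opprK, oppr0).

(** Once products are distributed, the noncommutative monomials serve as atoms for [abel]. *)
Ltac ncring := expand; abel.

(** * Submodules and spans over a commutative ring *)

Section Submodules.
Variables (K : comPzRingType) (V : lmodType K).
Implicit Types (A B : set V) (J : set K) (s : seq V).

Definition submodule A : Prop :=
  [/\ A 0, (forall x y, A x -> A y -> A (x + y)) &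
      forall k x, A x -> A (k *: x)].

Lemma submodule0 A : submodule A -> A 0. Proof. by case. Qed.

Lemma submoduleD A x y : submodule A -> A x -> A y -> A (x + y).
Proof. by case=> _ h _; apply: h. Qed.

Lemma submoduleZ A k x : submodule A -> A x -> A (k *: x).
Proof. by case=> _ _ h; apply: h. Qed.

Lemma submoduleN A x : submodule A -> A x -> A (- x).
Proof. by move=> sA Ax; rewrite -scaleN1r; apply: submoduleZ. Qed.

Lemma submoduleB A x y : submodule A -> A x -> A y -> A (x - y).
Proof. by move=> sA Ax Ay; apply: submoduleD => //; apply: submoduleN. Qed.

Lemma submodule_sum A n (f : 'I_n -> V) :
  submodule A -> (forall i, A (f i)) -> A (\sum_(i < n) f i).
Proof.
move=> sA Af; elim/big_ind: _ => //; first exact: submodule0.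
by move=> x y; apply: submoduleD.
Qed.

(** The recursion peels off one generator at a time, as the inductions on generators require;
    [span_coefs] recovers linear combinations. *)
Fixpoint span s : set V :=
  if s is x :: s' then [set v | exists k, span s' (v - k *: x)] else [set 0].

Lemma submodule_span s : submodule (span s).
Proof.
elim: s => [|x s IH] /=; split=> /=.
- by [].
- by move=> ? ? -> ->; rewrite addr0.
- by move=> k ? ->; rewrite scaler0.
- by exists 0; rewrite scale0r subr0; apply: submodule0.
- move=> u v [k hk] [l hl]; exists (k + l).
  by rewrite scalerDl opprD addrACA; apply: submoduleD.
- move=> a u [k hk]; exists (a * k).
  by rewrite -scalerA -scalerBr; apply: submoduleZ.
Qed.

Lemma span_cons x s : span s `<=` span (x :: s).
Proof. by move=> v sv; exists 0; rewrite scale0r subr0. Qed.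

Lemma span_head x s : span (x :: s) x.
Proof. by exists 1; rewrite scale1r subrr; apply: (submodule0 (submodule_span s)). Qed.

Lemma mem_span x s : x \in s -> span s x.
Proof.
elim: s => //= y s IH; rewrite inE => /orP[/eqP ->|/IH]; first exact: span_head.
exact: span_cons.
Qed.

Lemma span_min A s : submodule A -> (forall i : 'I_(size s), A s`_i) -> span s `<=` A.
Proof.
move=> sA; elim: s => [|x s IH] hs v /=; first by move=> ->; apply: submodule0.
case=> k /IH h; rewrite -(subrK (k *: x) v); apply: submoduleD => //.
  by apply: h => i; apply: (hs (lift ord0 i)).
by apply: submoduleZ => //; apply: (hs ord0).
Qed.

(** The coefficients range over an ideal: all of [K] in [span_coefs], a power of an ideal in
    [adic_module_limit]. *)
Lemma submodule_span_coefs s (I : set K) :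
  (forall a b, I a -> I b -> I (a + b)) -> I 0 -> (forall k a, I a -> I (k * a)) ->
  submodule [set v | exists c : 'I_(size s) -> K,
    (forall i, I (c i)) /\ v = \sum_(i < size s) c i *: s`_i].
Proof.
move=> ID I0 IM; split=> /=.
- by exists (fun=> 0); split=> //; rewrite big1 // => i _; rewrite scale0r.
- move=> u v [c [Ic ->]] [d [Id ->]]; exists (fun i => c i + d i); split; first by auto.
  by rewrite -big_split /=; apply: eq_bigr => i _; rewrite scalerDl.
- move=> k u [c [Ic ->]]; exists (fun i => k * c i); split; first by auto.
  by rewrite scaler_sumr; apply: eq_bigr => i _; rewrite scalerA.
Qed.

Lemma span_coefs s v :
  span s v <-> exists c : 'I_(size s) -> K, v = \sum_(i < size s) c i *: s`_i.
Proof.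
split; last first.
  case=> c ->; apply: submodule_sum; first exact: submodule_span.
  move=> i; apply: submoduleZ; first exact: submodule_span.
  exact/mem_span/mem_nth.
suff sub : span s `<=` [set v | exists c : 'I_(size s) -> K,
    (forall i, setT (c i)) /\ v = \sum_(i < size s) c i *: s`_i].
  by move=> /sub [c [_ ->]]; exists c.
apply: span_min; first exact: submodule_span_coefs.
move=> i; exists (fun j => (j == i)%:R); split=> //.
rewrite (bigD1 i) //= eqxx scale1r big1 ?addr0 // => j /negPf ->.
by rewrite scale0r.
Qed.

Lemma finitely_generated_span A : finitely_generated A -> exists s, A = span s.
Proof.
by case=> s ->; exists s; rewrite predeqE => v; split => /span_coefs.
Qed.

(* The submodule generated by the products a *: v with a in J. *)
Definition set_scale J : set V :=
  [set x | forall A, submodule A -> (forall a v, J a -> A (a *: v)) -> A x].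

Lemma submodule_set_scale J : submodule (set_scale J).
Proof.
split=> [A sA _|x y hx hy A sA h|k x hx A sA h]; first exact: submodule0.
  by apply: submoduleD => //; [apply: hx|apply: hy].
by apply: submoduleZ => //; apply: hx.
Qed.

Lemma set_scaleZ J a v : J a -> set_scale J (a *: v).
Proof. by move=> Ja A _; apply. Qed.

Lemma submoduleI A B : submodule A -> submodule B -> submodule (A `&` B).
Proof.
move=> sA sB; split; first by split; apply: submodule0.
  by move=> x y [? ?] [? ?]; split; apply: submoduleD.
by move=> k x [? ?]; split; apply: submoduleZ.
Qed.

Definition submodule_sum_set A B : set V := [set v | exists2 a, A a & B (v - a)].

Lemma submodule_add A B : submodule A -> submodule B -> submodule (submodule_sum_set A B).
Proof.
move=> sA sB; split.
- by exists 0; rewrite ?subr0; apply: submodule0.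
- move=> x y [a Aa Ba] [b Ab Bb]; exists (a + b); first exact: submoduleD.
  by rewrite opprD addrACA; apply: submoduleD.
- move=> k x [a Aa Ba]; exists (k *: a); first exact: submoduleZ.
  by rewrite -scalerBr; apply: submoduleZ.
Qed.

End Submodules.

(** * Chain conditions and their passage to finitely generated modules *)

Section Extremal.

(* b selects the direction: chain conditions are stated for both orders at once. *)
Definition le_dir T (b : bool) (A B : set T) : Prop := if b then A `<=` B else B `<=` A.

Definition extremal T b (F : set (set T)) : Prop :=
  exists2 A, F A & forall B, F B -> le_dir b A B -> B = A.

(** The submodules compared contain [J W]. The maximum condition is used with [J] empty, the minimum
    condition with [J] the radical of [K]. *)
Definition extremal_submodules (K : comPzRingType) b (J : set K) (V : lmodType K)
    (W : set V) : Prop :=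
  forall F : set (set V), F !=set0 ->
    (forall A, F A -> [/\ submodule A, A `<=` W &
       forall a v, J a -> W v -> A (a *: v)]) ->
  extremal b F.

Variables (K : comPzRingType) (b : bool) (J : set K) (V : lmodType K).
Hypothesis extremal_ideals : extremal_submodules b J (setT : set K^o).
Implicit Types (A B : set V) (s : seq V).

(** Induction on the generators: a submodule [A] of the span of [x :: s] is governed by the ideal
    [al A] of coefficients of [x] in [A] and by its intersection with [span s]. The two are made
    extremal one after the other. *)
Lemma extremal_span s : extremal_submodules b J (span s).
Proof.
elim: s => [|x s IH] F [A0 FA0] hF /=.
  have F0 A : F A -> A = [set 0].
    move=> FA; have [sA hA _] := hF A FA; apply/seteqP; split => // v ->.
    exact: submodule0.
  by exists A0 => // B /F0 -> _; rewrite (F0 _ FA0).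
have sS := submodule_span s.
pose al A : set K^o := [set k : K | submodule_sum_set A (span s) (k *: x)].
have [||_ [A1 FA1 <-] ext1] := @extremal_ideals (al @` F).
- by exists (al A0), A0.
- move=> _ [A FA <-]; have [sA hA JA] := hF A FA; split=> //.
    have sAS := submodule_add sA sS; split; rewrite /al /=.
    - by rewrite scale0r; apply: submodule0.
    - by move=> k l hk hl; rewrite scalerDl; apply: submoduleD.
    - by move=> k l hk; rewrite -scalerA; apply: submoduleZ.
  move=> a v Ja _; exists ((a * v) *: x); last by rewrite subrr; apply: submodule0.
  by rewrite -scalerA; apply: JA => //; apply: submoduleZ (span_head _ _); apply: submodule_span.
have [||_ [A [FA alA] <-] ext2] := IH ((fun A => A `&` span s) @` [set A | F A /\ al A = al A1]).
- by exists (A1 `&` span s), A1.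
- move=> _ [A [FA _] <-]; have [sA hA JA] := hF A FA; split=> //.
  - exact: submoduleI.
  - move=> a v Ja sv; split; last exact: submoduleZ.
    by apply: JA => //; apply: span_cons.
exists A => // B FB leAB.
have alB : al B = al A1.
  apply: ext1; first by exists B.
  rewrite -alA /al /le_dir; case: (b) leAB => /= leAB k [a Aa ha]; exists a => //;
    exact: leAB.
have eBA : B `&` span s = A `&` span s.
  apply: ext2; first by exists B.
  by rewrite /le_dir; case: (b) leAB => /= leAB v [? ?]; split => //; apply: leAB.
(* Modular law: nested submodules with the same coefficient ideal and the same intersection with
   [span s] coincide. *)
have modular (C D : set V) : F C -> F D -> C `<=` D -> al D = al C ->
    D `&` span s = C `&` span s -> D `<=` C.
  move=> FC FD CD alCD eCD v Dv.
  have [sC hC _] := hF C FC; have [sD hD _] := hF D FD.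
  have [k hk] : span (x :: s) v by apply: hD.
  have : al D k.
    exists v => //; rewrite -opprB; exact: submoduleN.
  rewrite alCD => -[c Cc hc].
  have : (D `&` span s) (v - c).
    split; first by apply: submoduleB => //; apply: CD.
    by rewrite -(subrKA (k *: x)); apply: submoduleD.
  by rewrite eCD => -[h _]; rewrite -(subrK c v); apply: submoduleD.
apply/seteqP; case: (b) leAB => /= leAB; split => //; apply: modular => //.
- by rewrite alB alA.
- by rewrite alA alB.
Qed.

End Extremal.

(** * The maximum condition from finite generation of ideals *)

Section Noetherian.
Variable K : comPzRingType.
Hypothesis K_noeth : noetherian K.

Lemma noetherian_acc : extremal_submodules true set0 (setT : set K^o).
Proof.
move=> F [A0 FA0] hF; apply: contrapT => nmax.
have /choice[g gP] (A : {A : set K^o | F A}) :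
    exists B : {A : set K^o | F A}, sval A `<=` sval B /\ sval B <> sval A.
  apply: contrapT => nB; apply: nmax; exists (sval A); first exact: svalP A.
  move=> B FB AB; apply: contrapT => BA; apply: nB.
  by exists (exist _ B FB).
pose f n := iter n g (exist _ A0 FA0).
have fS n : sval (f n) `<=` sval (f n.+1) by case: (gP (f n)).
have fle m n : (m <= n)%N -> sval (f m) `<=` sval (f n).
  elim: n => [|n IH]; first by rewrite leqn0 => /eqP ->.
  rewrite leq_eqVlt => /orP[/eqP -> //|]; rewrite ltnS => /IH h.
  by apply: subset_trans (fS n).
have sf n : submodule (sval (f n)) by case: (hF _ (svalP (f n))).
pose U : set K^o := [set k | exists n, sval (f n) k].
have lU : left_ideal (U : set K).
  split; first by exists 0%N; apply: (submodule0 (sf _)).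
    move=> x y [m hx] [n hy]; exists (maxn m n); apply: (submoduleD (sf _)).
      by apply: fle hx; apply: leq_maxl.
    by apply: fle hy; apply: leq_maxr.
  by move=> a x [m hx]; exists m; apply: (submoduleZ a (sf m) hx).
have [s Us] := finitely_generated_span (K_noeth lU).
have [n hn] : exists n, span s `<=` sval (f n).
  have : span s `<=` U by rewrite -Us.
  elim: (s) => [|x t IH] hU.
    by exists 0%N => v ->; apply: submodule0.
  have [|n hn] := IH; first by apply: subset_trans hU; apply: span_cons.
  have [m hm] := hU _ (span_head x t).
  exists (maxn m n) => v [k hv]; rewrite -(subrK (k *: x) v); apply: submoduleD => //.
    by apply: fle (hn _ hv); apply: leq_maxr.
  by apply: submoduleZ => //; apply: fle hm; apply: leq_maxl.
have [_] := gP (f n); apply; apply/seteqP; split; last exact: fS.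
by move=> v hv; apply: hn; rewrite -Us; exists n.+1.
Qed.

End Noetherian.

(** * Adic limits, the Jacobson radical and the minimum condition modulo it *)

Section SemilocalRing.
Variable K : comPzRingType.
Implicit Types (A B : set K^o) (J : set K).

Lemma submodule_Jac : submodule (Jac K : set K^o).
Proof.
split=> [I [[]] //|x y hx hy I mI|k x hx I mI].
  by have [[_ ID _] _ _] := mI; apply: ID; [apply: hx|apply: hy].
by have [[_ _ IM] _ _] := mI; apply: IM; apply: hx.
Qed.

Lemma submodule_ideal_mul J (A : set K) :
  submodule (J : set K^o) -> submodule (ideal_mul J A : set K^o).
Proof.
move=> sJ; split.
- by exists [::]; split => //; rewrite big_nil.
- move=> _ _ [s [hs ->]] [t [ht ->]]; exists (s ++ t); rewrite big_cat; split=> // p.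
  by rewrite mem_cat => /orP[/hs|/ht].
- move=> k _ [s [hs ->]]; exists [seq (k * p.1, p.2) | p <- s]; split.
    move=> _ /mapP[p /hs[h1 h2] ->] /=; split=> //.
    exact: (submoduleZ k sJ h1).
  by rewrite big_map scaler_sumr; apply: eq_bigr => p _ /=; rewrite -mulrA.
Qed.

Lemma submodule_ideal_exp J n :
  submodule (J : set K^o) -> submodule (ideal_exp J n : set K^o).
Proof.
case: n => [|n] sJ; first by split.
exact: submodule_ideal_mul.
Qed.

Lemma ideal_mulM J (A : set K) a x : J a -> A x -> ideal_mul J A (a * x).
Proof.
move=> Ja Ax; exists [:: (a, x)]; rewrite big_seq1; split=> // p.
by rewrite inE => /eqP ->.
Qed.

Lemma ideal_exp_le J m n : submodule (J : set K^o) -> (m <= n)%N ->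
  ideal_exp J n `<=` ideal_exp J m.
Proof.
move=> sJ; elim: n m => [|n IH] [|m] //= mn x [s [hs ->]]; exists s; split=> // p ps.
by have [? ?] := hs p ps; split => //; apply: (IH m).
Qed.

(** The nested cosets of the [x n] form a point of the inverse limit, which surjectivity of the
    completion map attains. *)
Lemma adic_cauchy_limit J (x : nat -> K) :
  submodule (J : set K^o) -> adically_complete J ->
  (forall n, ideal_exp J n (x n.+1 - x n)) ->
  exists y, forall n, ideal_exp J n (x n - y).
Proof.
move=> sJ [_ _ surj] hx.
have [|y _ hy] := surj (fun n => adic_coset J n (x n)).
  split=> [n|n z /= hz]; first by exists (x n).
  rewrite /adic_coset /= -(subrKA (x n.+1)).
  apply: (submoduleD (submodule_ideal_exp n sJ)) => //.
  exact: (ideal_exp_le sJ (leqnSn n)).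
exists y => n; have : adic_coset J n (x n) (x n).
  by rewrite /adic_coset /= subrr; apply: (submodule0 (submodule_ideal_exp n sJ)).
by rewrite -(congr1 (fun f => f n) hy).
Qed.

Hypothesis K_noeth : noetherian K.

(** Otherwise [1 - a] lies in a maximal ideal, supplied by the maximum condition; this ideal also
    contains [a], hence [1]. *)
Lemma Jac_unit a : Jac K a -> exists z : K, z * (1 - a) = 1.
Proof.
move=> Ja; apply: contrapT => nu.
pose L : set K^o := [set k * (1 - a) | k in [set: K]].
have [||A [sA nA LA] Amax] := @noetherian_acc K K_noeth
    [set A : set K^o | [/\ submodule A, ~ A 1 & L `<=` A]].
- exists L; split=> //; last by case=> k _ h; apply: nu; exists k.
  split; first by exists 0 => //; rewrite mul0r.
    by move=> _ _ [k _ <-] [l _ <-]; exists (k + l) => //; rewrite mulrDl.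
  by move=> k _ [l _ <-]; exists (k * l) => //; rewrite -mulrA.
- by move=> A [].
apply: (nA); rewrite -(subrK a 1); apply: (submoduleD sA).
  by apply: LA; exists 1 => //; rewrite mul1r.
apply: Ja; split=> //.
move=> B lB nB AB; apply: Amax => //; split=> //.
exact: subset_trans AB.
Qed.

Hypothesis K_sl : semilocal K.

Lemma semilocal_complement A : submodule A -> Jac K `<=` A ->
  exists C : set K^o, [/\ submodule C, A `&` C `<=` Jac K &
    forall v, exists2 a, A a & C (v - a)].
Proof.
move=> sA JA; have [S [pi [pi_surj pi_ker ss]]] := K_sl.
have lpA : left_ideal [set pi a | a in A].
  split; first by exists 0; [apply: (submodule0 sA)|rewrite rmorph0].
    move=> _ _ [a Aa <-] [b Ab <-]; exists (a + b); last by rewrite rmorphD.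
    exact: (submoduleD sA).
  move=> t _ [a Aa <-]; have [k <-] := pi_surj t; exists (k * a); last by rewrite rmorphM.
  exact: (submoduleZ k sA Aa).
have [L [[L0 LD LM] AL dec]] := ss _ lpA.
exists [set k | L (pi k)]; split.
- split=> [|x y hx hy|k x hx] /=; first by rewrite rmorph0.
    by rewrite rmorphD; apply: LD.
  by rewrite (_ : k *: x = k * x) // rmorphM; apply: LM.
- move=> k [Ak Lk]; apply/pi_ker; suff : ([set pi a | a in A] `&` L) (pi k) by rewrite AL.
  by split=> //; exists k.
- move=> v; have [_ [z [[a Aa <-] Lz e]]] := dec (pi v).
  by exists a => //=; rewrite rmorphB e addrAC subrr add0r.
Qed.

(** Complements modulo the radical reverse inclusions. Let [N] be maximal among the complements of
    members of [F], and let it belong to [A]. If [B] in [F] lies in [A] and has complement [C], then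
    [N] plus the intersection of [C] and [A] is a complement of [B], hence equals [N]; so that
    intersection lies in the radical and [A] in [B]. *)
Lemma semilocal_dcc : extremal_submodules false (Jac K) (setT : set K^o).
Proof.
move=> F [A0 FA0] hF.
have JF A : F A -> Jac K `<=` A.
  by move=> /hF[_ _ JA] k Jk; rewrite -(mulr1 k); apply: (JA k (1 : K^o)).
pose G : set (set K^o) := [set N | submodule N /\ exists2 A, F A &
  A `&` N `<=` Jac K /\ forall v, exists2 a, A a & N (v - a)].
have [sA0 _ _] := hF A0 FA0.
have [||N [sN [A FA [AN1 AN2]]] Nmax] := @noetherian_acc K K_noeth G.
- have [C [sC h1 h2]] := semilocal_complement sA0 (JF _ FA0).
  by exists C; split=> //; exists A0.
- by move=> N' [? _].
have [sA _ _] := hF A FA.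
exists A => // B FB BA; apply/seteqP; split=> // a Aa.
have [sB _ _] := hF B FB.
have [C [sC BC1 BC2]] := semilocal_complement sB (JF _ FB).
have sCA := submoduleI sC sA.
have NE : submodule_sum_set N (C `&` A) = N.
  apply: Nmax; last first.
    by move=> n Nn; exists n => //; rewrite subrr; apply: submodule0.
  split; first exact: submodule_add.
  exists B => //; split.
    move=> b [Bb [n Nn [Cc Ac]]].
    have Jn : Jac K n.
      apply: AN1; split=> //; rewrite -(subKr b n).
      by apply: (submoduleB sA) => //; apply: BA.
    rewrite -(subrK n b); apply: (submoduleD submodule_Jac) => //.
    by apply: BC1; split=> //; apply: (submoduleB sB) => //; apply: JF Jn.
  move=> v; have [u Au Nvu] := AN2 v; have [b Bb Cub] := BC2 u.
  exists b => //; exists (v - u) => //.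
  have -> : v - b - (v - u) = u - b by abel.
  by split=> //; apply: (submoduleB sA) => //; apply: BA.
have [b Bb Cab] := BC2 a.
rewrite -(subrK b a); apply: (submoduleD sB) => //; apply: (JF _ FB).
have Aab : A (a - b) by apply: (submoduleB sA) => //; apply: BA.
apply: AN1; split=> //; rewrite -NE; exists 0; first exact: submodule0.
by rewrite subr0.
Qed.

End SemilocalRing.

(** * Nakayama's lemma, Krull's intersection theorem and adic limits in finitely generated
    modules *)

Section FinitelyGeneratedModules.
Variable K : comPzRingType.
Hypotheses (K_noeth : noetherian K) (K_sl : semilocal K).
Variable V : lmodType K.
Hypothesis V_fg : finitely_generated (setT : set V).
Implicit Types (A C : set V).

Lemma fg_acc : extremal_submodules true set0 (setT : set V).
Proof.
have [s ->] := finitely_generated_span V_fg.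
by apply: extremal_span; apply: noetherian_acc.
Qed.

Lemma fg_dcc : extremal_submodules false (Jac K) (setT : set V).
Proof.
have [s ->] := finitely_generated_span V_fg.
by apply: extremal_span; apply: semilocal_dcc.
Qed.

Lemma fg_chain_stable (f : nat -> set V) :
  (forall n, submodule (f n)) -> (forall n, f n `<=` f n.+1) ->
  exists n, f n.+1 = f n.
Proof.
move=> sf fS; have [||_ [n _ <-] h] := fg_acc (F := range f).
- by exists (f 0%N), 0%N.
- by move=> _ [n _ <-]; split.
by exists n; apply: h; [exists n.+1|apply: fS].
Qed.

(** Generators are discarded one at a time: modulo [A] and the span of the others, [x] equals
    [j *: x] with [j] in the radical, and [1 - j] is a unit. *)
Lemma nakayama A : submodule A ->
  (forall v, exists2 a, A a & set_scale (Jac K) (v - a)) -> forall v, A v.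
Proof.
move=> sA AJ; have [s Vs] := finitely_generated_span V_fg.
have : forall v, submodule_sum_set A (span s) v.
  move=> v; exists 0; first exact: submodule0.
  by rewrite -Vs.
elim: s {Vs} => [|x s IH] h v.
  by have [a Aa /= /subr0_eq ->] := h v.
apply: IH => {}v; have sS := submodule_span s.
have sAS := submodule_add sA sS.
have Ax : submodule_sum_set A (span s) x.
  have [a Aa] := AJ x.
  suff sub : set_scale (Jac K) `<=` [set v | exists2 j, Jac K j &
      submodule_sum_set A (span s) (v - j *: x)].
    move=> /sub[j Jj hj]; have [z hz] := Jac_unit K_noeth Jj.
    rewrite -(scale1r x) -hz -scalerA; apply: submoduleZ => //.
    rewrite scalerBl scale1r (_ : x - _ = a + (x - a - j *: x)); last by abel.
    apply: submoduleD => //.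
    by exists a => //; rewrite subrr; apply: submodule0.
  move=> w; apply.
    split.
    - exists 0; first exact: (submodule0 (@submodule_Jac K)).
      by rewrite scale0r subr0; apply: submodule0.
    - move=> u t [i Ji hi] [j Jj hj]; exists (i + j).
        exact: (submoduleD (@submodule_Jac K)).
      by rewrite scalerDl opprD addrACA; apply: submoduleD.
    - move=> k u [i Ji hi]; exists (k * i).
        exact: (submoduleZ k (@submodule_Jac K) Ji).
      by rewrite -scalerA -scalerBr; apply: submoduleZ.
  move=> j u Jj; have [b Ab [k hk]] := h u.
  exists (j * k).
    by rewrite mulrC; apply: (submoduleZ k (@submodule_Jac K) Jj).
  rewrite -scalerA -scalerBr; apply: submoduleZ => //.
  by exists b => //; rewrite addrAC.
have [a Aa [k hk]] := h v.
rewrite -(subrK (k *: x) v); apply: submoduleD => //; last exact: submoduleZ.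
by exists a => //; rewrite addrAC.
Qed.

(** For a submodule [C] this is the quotient (C : J^n), reached one factor at a time. *)
Fixpoint transporter (J : set K) n C : set V :=
  if n is m.+1 then [set v | forall a, J a -> transporter J m C (a *: v)] else C.

Lemma transporterD J m n C :
  transporter J (m + n) C = transporter J m (transporter J n C).
Proof. by elim: m => //= m ->. Qed.

Lemma transporterS J n C C' : C `<=` C' -> transporter J n C `<=` transporter J n C'.
Proof. by move=> h; elim: n => //= n IH v hv a Ja; apply/IH/hv. Qed.

Lemma transporter_ideal_exp J n C a v : submodule C ->
  ideal_exp J n a -> transporter J n C v -> C (a *: v).
Proof.
move=> sC; elim: n a v => [|n IH] a v /=; first by move=> _; apply: submoduleZ.
case=> s [hs ->] hv; rewrite scaler_suml.
rewrite big_seq; elim/big_ind: _; first exact: submodule0.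
  by move=> x y; apply: submoduleD.
by move=> p /hs[Jp Ep]; rewrite mulrC -scalerA; apply: IH => //; apply: hv.
Qed.

(** Induction on the generators of the ideal. With [D m] = C + a^m V, a product of [N] elements of
    the ideal carries [D m] into [D m.+1]: factors from [span s] alone end in [C], and any factor
    involving [a] raises the exponent. Finally [D n] is [C]. *)
Lemma transporter_nilpotent (s : seq K^o) C : submodule C ->
  (forall a : K, (a : K^o) \in s -> exists n, forall v, C (a ^+ n *: v)) ->
  exists n, forall v, transporter (@span K K^o s) n C v.
Proof.
move=> sC; elim: s => [|a s IH] hs.
  by exists 1%N => v b /= ->; rewrite scale0r; apply: submodule0.
have [b bs|N hN] := IH; first by apply: hs; rewrite inE bs orbT.
have [n hn] := hs a (mem_head _ _).
pose S : set K := @span K K^o (a :: s).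
pose D m : set V := [set v | exists u, C (v - (a : K) ^+ m *: u)].
have sD m : submodule (D m).
  split.
  - by exists 0; rewrite scaler0 subr0; apply: submodule0.
  - move=> u v [x hx] [y hy]; exists (x + y).
    by rewrite scalerDr opprD addrACA; apply: submoduleD.
  - move=> k u [x hx]; exists (k *: x).
    by rewrite scalerA mulrC -scalerA -scalerBr; apply: submoduleZ.
have step m k u w : transporter (@span K K^o s) k C u -> D m.+1 w ->
    transporter S k (D m.+1) ((a : K) ^+ m *: u + w).
  elim: k u w => [|k IHk] u w /= hu hw.
    apply: (submoduleD (sD _)) => //; exists 0; rewrite scaler0 subr0.
    exact: submoduleZ.
  move=> b [l hl]; pose c : K := b - l * a; have eb : b = c + l * a by rewrite subrK.
  have -> : b *: ((a : K) ^+ m *: u + w) =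
      (a : K) ^+ m *: (c *: u) + (((a : K) ^+ m.+1 * l) *: u + b *: w).
    rewrite scalerDr scalerA {1}eb addrA scalerA -scalerDl; congr (_ *: _ + _).
    by rewrite mulrDl exprS !(mulrC _ c) -(mulrC l) mulrA.
  apply: IHk; first exact: hu.
  apply: (submoduleD (sD _)); last exact: submoduleZ.
  by exists (l *: u); rewrite scalerA subrr; apply: submodule0.
have main m v : transporter S (m * N) (D m) v.
  elim: m v => [|m IHm] v.
    by exists v; rewrite expr0 scale1r subrr; apply: submodule0.
  rewrite mulSnr transporterD; apply: transporterS (IHm v) => {}v [u hu].
  rewrite -(subrK ((a : K) ^+ m *: u) v) addrC; apply: step => //.
  by exists 0; rewrite scaler0 subr0.
exists (n * N)%N => v; apply: transporterS (main n v) => {}v [u hu].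
by rewrite -(subrK ((a : K) ^+ n *: u) v); apply: submoduleD.
Qed.

(* A submodule C maximal subject to C `&` K x = Jac(K) x absorbs a power of
   Jac(K) times the module. *)
Lemma krull_intersection (x : V) :
  (forall n, set_scale (ideal_exp (Jac K) n) x) -> x = 0.
Proof.
move=> hx; have sJ := @submodule_Jac K.
pose F : set (set V) := [set C | [/\ submodule C, (forall j, Jac K j -> C (j *: x)) &
  forall k : K, C (k *: x) -> exists2 j, Jac K j & k *: x = j *: x]].
have [||C [sC CJ CK] Cmax] := fg_acc (F := F).
- exists [set j *: x | j in Jac K]; split.
  - split; first by exists 0; [apply: (submodule0 sJ)|rewrite scale0r].
      move=> _ _ [i Ji <-] [j Jj <-]; exists (i + j); last by rewrite scalerDl.
      exact: (submoduleD sJ).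
    move=> k _ [i Ji <-]; exists (k * i); last by rewrite scalerA.
    exact: (submoduleZ k sJ Ji).
  - by move=> j Jj; exists j.
  - by move=> k [j Jj <-]; exists j.
- by move=> C [].
have Jnil a : Jac K a -> exists n, forall v, C (a ^+ n *: v).
  move=> Ja; have [||n fn] := @fg_chain_stable (fun n => [set v | C (a ^+ n *: v)]).
  - move=> n; split=> /= [|u v|k u]; first by rewrite scaler0; apply: submodule0.
      by rewrite scalerDr; apply: submoduleD.
    by rewrite scalerA mulrC -scalerA; apply: submoduleZ.
  - by move=> n v /=; rewrite exprS -scalerA; apply: submoduleZ.
  exists n => v.
  (* Maximality forces C + a^n V = C once this sum is known to stay in [F]; stability of the chain
     (C : a^n) keeps its intersection with K x inside Jac(K) x. *)
  suff <- : [set w | exists u, C (w - a ^+ n *: u)] = C.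
    by exists v; rewrite subrr; apply: submodule0.
  apply: Cmax; last by move=> c Cc; exists 0; rewrite scaler0 subr0.
  split.
  - split.
    - by exists 0; rewrite scaler0 subr0; apply: submodule0.
    - move=> u w [y hy] [z hz]; exists (y + z).
      by rewrite scalerDr opprD addrACA; apply: submoduleD.
    - move=> k u [y hy]; exists (k *: y).
      by rewrite scalerA mulrC -scalerA -scalerBr; apply: submoduleZ.
  - by move=> j Jj; exists 0; rewrite scaler0 subr0; apply: CJ.
  - move=> k [u hu]; apply: CK.
    rewrite -(subrK (a ^+ n *: u) (k *: x)); apply: submoduleD => //.
    suff : [set v | C (a ^+ n.+1 *: v)] u by rewrite fn.
    rewrite /= exprS -scalerA -(subKr (a *: (k *: x)) (a *: _)) -scalerBr.
    apply: submoduleB => //; last exact: submoduleZ.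
    by rewrite scalerA; apply: CJ; rewrite mulrC; apply: (submoduleZ k sJ Ja).
have [s Js] := finitely_generated_span (K_noeth (let: And3 a b c := sJ in And3 a b c)).
have [n hn] : exists n, forall v, transporter (@span K K^o s) n C v.
  apply: transporter_nilpotent => // a sa; apply: Jnil; rewrite Js.
  exact: mem_span.
have Cx : C x.
  apply: (hx n C) => // a v Ja; apply: transporter_ideal_exp (hn v) => //.
  by rewrite -Js.
have [j Jj] := CK 1 (submoduleZ 1 sC Cx).
rewrite scale1r => xj; have [z hz] := Jac_unit K_noeth Jj.
by rewrite -(scale1r x) -hz -scalerA scalerBl scale1r -xj subrr scaler0.
Qed.

(** The successive differences are written on the generators with coefficients in J^n, and the limit
    is taken coefficient by coefficient in [K]. *)
Lemma adic_module_limit (J : set K) (x : nat -> V) :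
  submodule (J : set K^o) -> adically_complete J ->
  (forall n, set_scale (ideal_exp J n) (x n.+1 - x n)) ->
  exists y, forall n, set_scale (ideal_exp J n) (x n - y).
Proof.
move=> sJ Jc hx; have [s Vs] := finitely_generated_span V_fg.
have sE n := submodule_ideal_exp n sJ.
have coef v : exists c : 'I_(size s) -> K, v = \sum_(i < size s) c i *: s`_i.
  by apply/span_coefs; rewrite -Vs.
have [c0 x0] := coef (x 0%N).
have /choice[d hd] n : exists d : 'I_(size s) -> K,
    (forall i, ideal_exp J n (d i)) /\ x n.+1 - x n = \sum_(i < size s) d i *: s`_i.
  apply: (hx n [set w | exists d : 'I_(size s) -> K,
    (forall i, ideal_exp J n (d i)) /\ w = \sum_(i < size s) d i *: s`_i]).
    apply: submodule_span_coefs => [a b||k a]; [exact: (submoduleD (sE n))| |].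
      exact: (submodule0 (sE n)).
    exact: (submoduleZ k (sE n)).
  move=> a v Ja; have [c ->] := coef v; exists (fun i => a * c i); split.
    by move=> i; rewrite mulrC; apply: (submoduleZ (c i) (sE n) Ja).
  by rewrite scaler_sumr; apply: eq_bigr => i _; rewrite scalerA.
pose X i n := c0 i + \sum_(m < n) d m i.
have hX n : x n = \sum_(i < size s) X i n *: s`_i.
  elim: n => [|n IH].
    by rewrite x0; apply: eq_bigr => i _; rewrite /X big_ord0 addr0.
  rewrite -(subrK (x n) (x n.+1)) (hd n).2 IH -big_split /=; apply: eq_bigr => i _ /=.
  by rewrite -scalerDl /X big_ord_recr addrC addrA.
have /choice[y hy] i : exists y, forall n, ideal_exp J n (X i n - y).
  apply: (@adic_cauchy_limit K J (X i)) => // n;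
    rewrite /X big_ord_recr /= addrA (addrC _ (d n i)) addrK.
  exact: (hd n).1.
exists (\sum_(i < size s) y i *: s`_i) => n.
rewrite hX -sumrB; apply: submodule_sum => [|i]; first exact: submodule_set_scale.
by rewrite -scalerBl; apply: set_scaleZ; apply: hy.
Qed.

End FinitelyGeneratedModules.

(** * Module-finite algebras: radical, regularity modulo the radical, lifting of idempotents *)

Section FiniteAlgebras.
Variable K : comPzRingType.
Hypotheses (K_noeth : noetherian K) (K_csl : complete_semilocal K).
Variable R : algType K.
Hypothesis R_fg : finitely_generated (setT : set R).
Implicit Types (a b c e p r t x y z : R) (k : K).

Let K_sl : semilocal K := proj1 K_csl.

Lemma submodule_mull y (A : set R) : submodule A -> submodule [set x | A (y * x)].
Proof.
move=> sA; split=> /= [|u v|k u]; first by rewrite mulr0; apply: submodule0.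
  by rewrite mulrDr; apply: submoduleD.
by rewrite -scalerAr; apply: submoduleZ.
Qed.

Lemma submodule_mulr y (A : set R) : submodule A -> submodule [set x | A (x * y)].
Proof.
move=> sA; split=> /= [|u v|k u]; first by rewrite mul0r; apply: submodule0.
  by rewrite mulrDl; apply: submoduleD.
by rewrite -scalerAl; apply: submoduleZ.
Qed.

(** The right annihilators of the powers of [a] stabilise. The element b^n (1 - b a) is killed by
    a^(n+1), hence by a^n, and a^n b^n = 1. *)
Lemma fg_dedekind_finite a b : a * b = 1 -> b * a = 1.
Proof.
move=> ab; have s0 : submodule [set (0 : R)].
  by split=> [|_ _ -> ->|k _ ->] //=; rewrite ?addr0 ?scaler0.
have [||n fn] := @fg_chain_stable K K_noeth R R_fg (fun n => [set v | a ^+ n * v = 0]).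
- by move=> n; apply: (submodule_mull (a ^+ n) s0).
- by move=> n v /= h; rewrite exprS -mulrA h mulr0.
have abn : a ^+ n * b ^+ n = 1.
  elim: (n) => [|m IH]; first by rewrite mulr1.
  by rewrite exprSr exprS mulrA -(mulrA _ a) ab mulr1.
have h : [set v | a ^+ n.+1 * v = 0] (b ^+ n * (1 - b * a)).
  by rewrite /= exprS -mulrA (mulrA (a ^+ n)) abn mul1r mulrBr mulr1 mulrA ab mul1r subrr.
by apply/esym/subr0_eq; move: h; rewrite fn /= mulrA abn mul1r.
Qed.

(** The Jacobson radical in elementwise form; by Dedekind finiteness the left inverses are
    two-sided. *)
Definition rad : set R := [set a | forall y, exists z, z * (1 - y * a) = 1].

Lemma rad_unit a : rad a -> exists2 z, z * (1 - a) = 1 & (1 - a) * z = 1.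
Proof.
by move=> /(_ 1)[z]; rewrite mul1r => hz; exists z => //; apply: fg_dedekind_finite.
Qed.

Lemma radMl y a : rad a -> rad (y * a).
Proof. by move=> ra z; rewrite mulrA; apply: ra. Qed.

Lemma radMr y a : rad a -> rad (a * y).
Proof.
(* The witness comes from the formula (1 - u v)^-1 = 1 + u (1 - v u)^-1 v. *)
move=> ra z; have [w hw] := ra (y * z); exists (1 + z * a * w * y).
have -> : (1 + z * a * w * y) * (1 - z * (a * y)) =
    1 - z * a * y + z * a * (w * (1 - y * z * a)) * y by ncring.
by rewrite hw; ncring.
Qed.

Lemma submodule_rad : submodule rad.
Proof.
split=> [y|a b ra rb y|k a ra].
- by exists 1; rewrite mulr0 subr0 mulr1.
- have [u hu] := ra y; have [z hz] := rb (u * y); exists (z * u).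
  by rewrite (_ : _ * _ = z * (u * (1 - y * a) - u * y * b)); [rewrite hu|ncring].
- by rewrite -(mul1r a) scalerAl; apply: radMl.
Qed.

Lemma rad0 : rad 0. Proof. exact: (submodule0 submodule_rad). Qed.
Lemma radD a b : rad a -> rad b -> rad (a + b).
Proof. exact: (submoduleD submodule_rad). Qed.
Lemma radB a b : rad a -> rad b -> rad (a - b).
Proof. exact: (submoduleB submodule_rad). Qed.
Lemma radN a : rad a -> rad (- a).
Proof. exact: (submoduleN submodule_rad). Qed.

Lemma set_scaleMl (J : set K) y a : set_scale J a -> set_scale J (y * a).
Proof.
move=> /(_ [set x | set_scale J (y * x)]); apply; first exact/submodule_mull/submodule_set_scale.
by move=> j v Jj /=; rewrite -scalerAr; apply: set_scaleZ.
Qed.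

Lemma set_scaleMr (J : set K) y a : set_scale J a -> set_scale J (a * y).
Proof.
move=> /(_ [set x | set_scale J (x * y)]); apply; first exact/submodule_mulr/submodule_set_scale.
by move=> j v Jj /=; rewrite -scalerAl; apply: set_scaleZ.
Qed.

Lemma set_scale_exp (J : set K) a n : submodule (J : set K^o) ->
  set_scale J a -> set_scale (ideal_exp J n) (a ^+ n).
Proof.
move=> sJ Ja; elim: n => [|n IH].
  by rewrite -(scale1r (a ^+ 0)); apply: set_scaleZ.
have sE := @submodule_set_scale K R (ideal_exp J n.+1).
rewrite exprS; apply: (Ja [set x | set_scale (ideal_exp J n.+1) (x * a ^+ n)]).
  exact/submodule_mulr/submodule_set_scale.
move=> j v Jj; rewrite /= -scalerAl.
apply: (@set_scaleMl _ v _ IH [set x | set_scale (ideal_exp J n.+1) (j *: x)]).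
  split=> /= [|u w|k u]; rewrite ?scaler0 ?scalerDr.
  - exact: submodule0.
  - exact: submoduleD.
  - by rewrite scalerA mulrC -scalerA; apply: submoduleZ.
by move=> i w Ei /=; rewrite scalerA; apply: set_scaleZ; apply: ideal_mulM.
Qed.

(** Nakayama applies to the left ideal R (1 - y a), which together with Jac(K) R is all of R. *)
Lemma set_scale_Jac_rad a : set_scale (Jac K) a -> rad a.
Proof.
move=> Ja y.
have [] := @nakayama K K_noeth R R_fg [set z * (1 - y * a) | z in setT] _ _ 1.
- split; first by exists 0 => //; rewrite mul0r.
    by move=> _ _ [u _ <-] [v _ <-]; exists (u + v) => //; rewrite mulrDl.
  by move=> k _ [u _ <-]; exists (k *: u) => //; rewrite scalerAl.
- move=> v; exists (v * (1 - y * a)); first by exists v.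
  rewrite (_ : v - _ = v * (y * a)); last by ncring.
  by do 2!apply: set_scaleMl.
by move=> z _; exists z.
Qed.

(** This rests on the factorisation 1 - (y a)^2 = (1 + y a) (1 - y a). *)
Lemma rad_semiprime a : (forall y, rad (a * y * a)) -> rad a.
Proof.
move=> h y; have [z hz] := h y y; exists (z * (1 + y * a)).
by rewrite -[RHS]hz; ncring.
Qed.

(** Brauer's argument: the minimum condition gives [a] in r R generating a minimal right ideal
    modulo the radical. As some a y a is not radical, a = a y a t modulo the radical, and e = a t y
    is the idempotent, because it fixes a y on the right. *)
Lemma rad_idempotent r : ~ rad r ->
  exists z, ~ rad (r * z) /\ rad (r * z * (r * z) - r * z).
Proof.
move=> nr.
have [||_ [u [nu ->]] umin] := fg_dcc K_noeth K_sl R_fg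
  (F := [set A | exists u, ~ rad (r * u) /\ A = [set v | exists t, rad (v - r * u * t)]]).
- by exists [set v | exists t, rad (v - r * 1 * t)], 1; rewrite mulr1.
- move=> _ [u [nu ->]]; split=> //.
    split; first by exists 0; rewrite mulr0 subr0; apply: rad0.
      by move=> x y [s hs] [t ht]; exists (s + t); rewrite mulrDr opprD addrACA; apply: radD.
    move=> k x [t ht]; exists (k *: t); rewrite -scalerAr -scalerBr.
    exact: (submoduleZ k submodule_rad).
  move=> k v Jk _; exists 0; rewrite mulr0 subr0.
  by apply: set_scale_Jac_rad; apply: set_scaleZ.
set a := r * u in nu umin *.
have simple s : ~ rad (a * s) -> exists t, rad (a - a * s * t).
  move=> ns.
  suff : [set v | exists t, rad (v - r * (u * s) * t)] a.
    by case=> t; rewrite mulrA => h; exists t.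
  rewrite (umin [set v | exists t, rad (v - r * (u * s) * t)]).
  - by exists 1; rewrite mulr1 subrr; apply: rad0.
  - by exists (u * s); rewrite mulrA.
  - by move=> v [t ht]; exists (s * t); move: ht; rewrite /a !mulrA.
have [y ny] : exists y, ~ rad (a * y * a).
  by apply: contrapT => /forallNP h; apply: nu; apply: rad_semiprime => y;
    apply: contrapT; apply: h.
have [|t ht] := simple (y * a); first by rewrite mulrA.
pose e := a * (t * y).
have aye : rad (a * y - a * y * e).
  rewrite (_ : _ - _ = (a - a * (y * a) * t) * y); last by rewrite /e; ncring.
  exact: radMr.
have rd : rad (e * e - e).
  have ayd : rad (a * y * (e * e - e)).
    rewrite (_ : _ * _ = - ((a * y - a * y * e) * e)); last by ncring.
    by apply: radN; apply: radMr.
  have de : e * e - e = a * (t * y * e - t * y) by rewrite /e; ncring.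
  apply: contrapT => nd; have [|t2 ht2] := simple (t * y * e - t * y).
    by rewrite -de.
  apply: ny; rewrite -(subrK (a * y * (e * e - e) * t2) (a * y * a)).
  apply: radD; last exact: radMr.
  rewrite (_ : _ - _ = a * y * (a - a * (t * y * e - t * y) * t2)); first exact: radMl.
  by rewrite -de; ncring.
have ne : ~ rad e.
  move=> re; apply: ny; apply: radMr; rewrite -(subrK (a * y * e) (a * y)).
  by apply: radD => //; apply: radMl.
by exists (u * (t * y)); rewrite mulrA -/a -/e.
Qed.

(* Among all c choose one for which the annihilator of p - p c p modulo the
   radical is maximal. *)
Lemma rad_regular p : exists c, rad (p - p * c * p).
Proof.
have [||_ [c _ <-] cmax] := fg_acc K_noeth R_fg
  (F := range (fun c => [set v | rad ((p - p * c * p) * v)])).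
- by exists [set v | rad ((p - p * 0 * p) * v)], 0.
- by move=> _ [c _ <-]; split=> //; apply: (submodule_mull _ submodule_rad).
exists c; apply: contrapT => /rad_idempotent.
set r := p - p * c * p in cmax * => -[z [nz iz]].
pose e := r * z; apply: nz.
(* This correction replaces the residue [r] by r - r z r, whose annihilator contains that of [r] and
   also z e. Maximality then puts e^2, hence [e], in the radical. *)
pose c' := c + (1 - c * p) * z * (1 - p * c).
have rc' : p - p * c' * p = r - r * z * r by rewrite /c' /r; ncring.
suff : rad (e * e).
  move=> h; rewrite -/e -(subKr (e * e) e); exact: radB.
rewrite (_ : e * e = r * (z * e)); last by rewrite mulrA.
have cE : [set v | rad ((r - r * z * r) * v)] = [set v | rad (r * v)].
  apply: cmax; first by exists c'; rewrite // rc'.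
  by move=> v /= hv; rewrite mulrBl -(mulrA _ r); apply: radB => //; apply: radMl.
suff : [set v | rad ((r - r * z * r) * v)] (z * e) by rewrite cE.
rewrite /= (_ : _ * _ = - ((e * e - e) * e)); last by rewrite /e; ncring.
by apply: radN; apply: radMr.
Qed.

(** The right ideals r^n R + Jac(K) R have a minimal member, so r^n (1 - r w) lies in Jac(K) R for
    some [w], and 1 - r w is a unit. *)
Lemma rad_nilpotent r : rad r -> exists n, set_scale (Jac K) (r ^+ n).
Proof.
move=> rr; have sJR := @submodule_set_scale K R (Jac K).
pose A n : set R := [set v | exists w, set_scale (Jac K) (v - r ^+ n * w)].
have [||_ [n _ <-] nmin] := fg_dcc K_noeth K_sl R_fg (F := range A).
- by exists (A 0%N), 0%N.
- move=> _ [n _ <-]; split=> //.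
    split; first by exists 0; rewrite mulr0 subr0; apply: (submodule0 sJR).
      move=> x y [u hu] [v hv]; exists (u + v).
      by rewrite mulrDr opprD addrACA; apply: (submoduleD sJR).
    by move=> k x [u hu]; exists (k *: u); rewrite -scalerAr -scalerBr; apply: (submoduleZ k sJR).
  by move=> k v Jk _; exists 0; rewrite mulr0 subr0; apply: set_scaleZ.
exists n; have : A n.+1 (r ^+ n).
  rewrite (nmin (A n.+1)); first by exists 1; rewrite mulr1 subrr; apply: (submodule0 sJR).
    by exists n.+1.
  by move=> v [w hw]; exists (r * w); rewrite mulrA -exprSr.
case=> w hw; have [z _ hz] := rad_unit (radMr w rr).
rewrite -(mulr1 (r ^+ n)) -hz mulrA; apply: set_scaleMr.
by rewrite mulrBr mulr1 mulrA -exprSr.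
Qed.

(** The polynomial 3 t^2 - 2 t^3, written without numerals so that [ncring] can expand it. *)
Definition newton_step t := t * t + t * t + t * t - (t * t * t + t * t * t).

(* Newton's iteration for t ^+ 2 = t squares the defect at each step. *)
Lemma idempotent_lift (P : set R) t :
  (forall x, P x -> P (newton_step x)) ->
  (forall x, (forall n, exists2 y, P y & set_scale (ideal_exp (Jac K) n) (x - y)) -> P x) ->
  P t -> rad (t * t - t) ->
  exists e, [/\ e * e = e, rad (e - t) & P e].
Proof.
move=> Pstep Pclosed Pt rt; have sJ := @submodule_Jac K.
have sJR m := @submodule_set_scale K R (ideal_exp (Jac K) m).
have [r rE] : exists r, r = t * t - t by exists (t * t - t).
rewrite -rE in rt; have [n hn] := rad_nilpotent rt.
pose x m := iter m newton_step t.
have Px m : P (x m) by elim: m => //= m; apply: Pstep.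
have xr m : x m * r = r * x m.
  elim: m => [|m IH]; first by rewrite rE; ncring.
  rewrite /= /newton_step -/(x m); move: (x m) IH => u IH.
  have c2 : u * u * r = r * (u * u) by rewrite -mulrA IH mulrA IH mulrA.
  have c3 : u * u * u * r = r * (u * u * u) by rewrite -mulrA IH mulrA c2 !mulrA.
  by rewrite mulrBl mulrBr !mulrDl !mulrDr c2 c3.
(* A linear growth of the exponent of [r] suffices: since r^n lies in Jac(K) R, it places the defect
   of [x (n * j)] in Jac(K)^j R. *)
have defect m : exists2 q, x m * x m - x m = r ^+ m.+1 * q & q * r = r * q.
  elim: m => [|m [q hq qr]]; first by exists 1; rewrite ?mulr1 ?mul1r ?rE.
  set u := x m in hq; have ur : u * r = r * u by apply: xr.
  (* With f = 3 u^2 - 2 u^3 one has f^2 - f = (u^2 - u)^2 (4 u^2 - 4 u - 3). *)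
  pose w := u * u + u * u + u * u + u * u - (u + u + u + u) - (1 + 1 + 1).
  have wr : w * r = r * w.
    have c2 : u * u * r = r * (u * u) by rewrite -mulrA ur mulrA ur mulrA.
    rewrite /w !mulrBl !mulrBr !mulrDl !mulrDr c2 ur; ncring.
  have qrm i : q * r ^+ i = r ^+ i * q.
    elim: i => [|i IH]; first by rewrite mulr1 mul1r.
    by rewrite exprS mulrA qr -mulrA IH mulrA.
  exists (r ^+ m * q * q * w).
    have -> : x m.+1 * x m.+1 - x m.+1 = (u * u - u) * (u * u - u) * w.
      by rewrite /= -/u /newton_step /w; ncring.
    by rewrite hq !mulrA -(mulrA _ q (r ^+ _)) qrm !mulrA -!exprD (addSnnS m.+1).
  rewrite -mulrA wr !mulrA -(mulrA _ q r) qr mulrA -(mulrA _ q r) qr mulrA.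
  by rewrite -exprSr exprS.
have hnk (j m : nat) : (n * j <= m)%N -> set_scale (ideal_exp (Jac K) j) (x m * x m - x m).
  move=> km; have [q -> _] := defect m; apply: set_scaleMr.
  rewrite -(subnK (leqW km)) exprD; apply: set_scaleMl; rewrite exprM.
  exact: set_scale_exp.
have dx m : x m.+1 - x m = (x m * x m - x m) * (1 - (x m + x m)).
  by rewrite /= /newton_step -/(x m); ncring.
have close (j i : nat) : set_scale (ideal_exp (Jac K) j) (x (n * j + i)%N - x (n * j)%N).
  elim: i => [|i IH]; first by rewrite addn0 subrr; apply: (submodule0 (sJR _)).
  rewrite addnS -(subrKA (x (n * j + i)%N)); apply: (submoduleD (sJR _)) => //.
  by rewrite dx; apply: set_scaleMr; apply: hnk; apply: leq_addr.
have [|e he] := adic_module_limit R_fg (x := fun j => x (n * j)%N) sJ (proj2 K_csl).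
  by move=> j; rewrite mulnS addnC.
exists e; split.
- apply: subr0_eq; apply: (krull_intersection K_noeth R_fg) => j.
  have -> : e * e - e = (x (n * j)%N * x (n * j)%N - x (n * j)%N) -
      ((x (n * j)%N - e) * x (n * j)%N + e * (x (n * j)%N - e) - (x (n * j)%N - e)).
    by ncring.
  apply: (submoduleB (sJR _)) => //; first exact: hnk.
  by apply: (submoduleB (sJR _)) => //; apply: (submoduleD (sJR _)) => //;
    [apply: set_scaleMr|apply: set_scaleMl].
- have rx m : rad (x m - t).
    elim: m => [|m IH]; first by rewrite subrr; apply: rad0.
    rewrite -(subrKA (x m)); apply: radD => //; rewrite dx; have [q -> _] := defect m.
    by rewrite exprS -!mulrA; apply: radMr.
  rewrite -(subrKA (x (n * 1)%N)); apply: radD => //.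
  rewrite -opprB; apply: radN; apply: set_scale_Jac_rad.
  apply: (he 1%N (set_scale (Jac K))); first exact: submodule_set_scale.
  move=> a v Ea; apply: set_scaleZ; have [s [hs ->]] := Ea.
  rewrite big_seq; elim/big_ind: _; first exact: (submodule0 sJ).
    by move=> u w; apply: (submoduleD sJ).
  by move=> q /hs[Jq _]; rewrite mulrC; apply: (submoduleZ q.2 sJ Jq).
- apply: Pclosed => j; exists (x (n * j)%N) => //.
  by rewrite -opprB; apply: (submoduleN (sJR _)).
Qed.

End FiniteAlgebras.

(** * Module-finite algebras with involution in which 2 is invertible *)

Section InvolutiveAlgebras.
Variable K : comPzRingType.
Hypotheses (K_noeth : noetherian K) (K_csl : complete_semilocal K).
Variable R : algType K.
Hypothesis R_fg : finitely_generated (setT : set R).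
Variable s : R -> R.
Hypotheses (sD : forall x y, s (x + y) = s x + s y)
  (sM : forall x y, s (x * y) = s y * s x) (sK : forall x, s (s x) = x)
  (sZ : forall k x, s (k *: x) = k *: s x).
Variable h : R.
Hypotheses (h2 : h + h = 1) (sh : s h = h) (hC : forall x, h * x = x * h).
Implicit Types (a b c e p q m t x y z : R).

Notation radR := (@rad K R).

Lemma invol0 : s 0 = 0.
Proof. by apply: (addrI (s 0)); rewrite -sD !addr0. Qed.

Lemma invol1 : s 1 = 1.
Proof. by rewrite -[LHS]mulr1 -[X in _ * X = _]sK -sM mulr1 sK. Qed.

Lemma involN x : s (- x) = - s x.
Proof. by apply: (addrI (s x)); rewrite -sD !subrr invol0. Qed.

Ltac snc := rewrite ?(sD, sM, involN, invol1, invol0, sK, sh); expand.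

Lemma rad_invol a : radR a -> radR (s a).
Proof.
move=> ra y; have [z _ hz] := rad_unit K_noeth R_fg (radMr (s y) ra); exists (s z).
rewrite (_ : _ * _ = s ((1 - a * s y) * z)); first by rewrite hz invol1.
by snc.
Qed.

Lemma rad_double a : radR (a + a) -> radR a.
Proof.
by move=> ra; rewrite -(mul1r a) -h2 mulrDl -mulrDr; apply: radMl.
Qed.

Lemma set_scale_invol (J : set K) a : set_scale J a -> set_scale J (s a).
Proof.
have sJ := @submodule_set_scale K R J.
move=> /(_ [set x | set_scale J (s x)]); apply.
  split=> /= [|x y|k x]; rewrite ?invol0 ?sD ?sZ.
  - exact: (submodule0 sJ).
  - exact: (submoduleD sJ).
  - exact: (submoduleZ k sJ).
by move=> k v Jk /=; rewrite sZ; apply: set_scaleZ.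
Qed.

(** The relation e a = a s(e) survives Newton steps and, by Krull's intersection theorem, adic
    limits; it is therefore an admissible predicate for [idempotent_lift]. *)
Lemma idempotent_lift_selfadjoint a t : s a = a -> t * a = a * s t ->
  radR (t * t - t) -> exists e, [/\ e * e = e, radR (e - t) & e * a = a * s e].
Proof.
move=> sa ta rt.
apply: (idempotent_lift K_noeth K_csl R_fg (P := [set e | e * a = a * s e])) => // x /=.
  move=> xa; rewrite /newton_step.
  have x2 : x * x * a = a * s x * s x by rewrite -mulrA xa mulrA xa.
  have x3 : x * x * x * a = a * s x * s x * s x by rewrite -mulrA xa mulrA x2.
  by snc; rewrite x2 x3.
move=> hx; apply/subr0_eq/(krull_intersection K_noeth R_fg) => n.
have [y /= ya xy] := hx n; have sJ := @submodule_set_scale K R (ideal_exp (Jac K) n).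
rewrite (_ : _ - _ = (x - y) * a - a * s (x - y)).
  apply: (submoduleB sJ); first exact: set_scaleMr.
  by apply: set_scaleMl; apply: set_scale_invol.
by snc; rewrite ya; abel.
Qed.

(** The idempotent a b modulo the radical lifts to [e] with e a symmetric. For u = e a and v0 = s(e)
    b e, the product u v0 differs from [e] by a radical element [r], and (1 - r)^-1 corrects v0 to a
    quasi-inverse. *)
Lemma symmetric_lift a b : s a = a -> s b = b -> radR (a * b * a - a) ->
  exists u v, [/\ s u = u, s v = v, u * v * u = u, v * u * v = v & radR (u - a)].
Proof.
move=> sa sb rab.
have [||e [ee re ea]] := @idempotent_lift_selfadjoint a (a * b) sa.
- by snc; rewrite sa sb.
- rewrite (_ : _ - _ = (a * b * a - a) * b); last by ncring.
  exact: radMr.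
pose u := e * a; pose v0 := s e * b * e.
have su : s u = u by rewrite /u sM sa -ea.
have sv0 : s v0 = v0 by rewrite /v0; snc; rewrite sb.
have eu : e * u = u by rewrite /u mulrA ee.
have v0e : v0 * e = v0 by rewrite /v0 -mulrA ee.
have ev0 : s e * v0 = v0 by rewrite /v0 !mulrA -sM ee.
pose r := e - u * v0.
have uv0 : u * v0 = e * a * b * e by rewrite /u /v0 !mulrA ea -(mulrA a) -sM ee.
have rr : radR r.
  have -> : r = e * (e - a * b) * e by rewrite /r uv0; expand; rewrite !ee.
  by apply: radMr; apply: radMl.
have [z zr rz] := rad_unit K_noeth R_fg rr.
have er : e * r = r by rewrite /r mulrBr ee mulrA eu.
have rE : r * e = r by rewrite /r mulrBl ee -mulrA v0e.
have ze : z * e = e * z.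
  have h1 : e * (1 - r) = (1 - r) * e by rewrite mulrBr mulrBl er rE mulr1 mul1r.
  have := congr1 (fun x => z * x * z) h1.
  by rewrite !mulrA zr mul1r -(mulrA (z * e)) rz mulr1.
(* Multiplied by s(z) on the left and by [z] on the right, this becomes the symmetry of v0 z. *)
have key : v0 * (1 - r) = (1 - s r) * v0.
  rewrite /r sD involN sM su sv0.
  by rewrite mulrBr mulrBl mul1r mulr1 mulrBr mulrBl v0e ev0 mulrA.
have uvz : u * (v0 * z) = e.
  rewrite mulrA (_ : u * v0 = e * (1 - r)); first by rewrite -mulrA rz mulr1.
  by rewrite mulrBr er mulr1 /r; abel.
exists u, (v0 * z); split=> //.
- have szr : s z * (1 - s r) = 1 by rewrite -invol1 -involN -sD -sM rz invol1.
  clearbody v0; have := congr1 (fun x => s z * x * z) key.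
  by rewrite !mulrA szr mul1r -(mulrA (s z * v0)) rz mulr1 sM sv0.
- by rewrite uvz.
- by rewrite -mulrA uvz -mulrA ze mulrA v0e.
- rewrite (_ : u - a = (e - a * b) * a + (a * b * a - a)); last by rewrite /u; ncring.
  by apply: radD => //; apply: radMr.
Qed.

(** A quasi-inverse is averaged with its image under the involution. *)
Lemma rad_regular_symmetric a : s a = a -> exists2 b, s b = b & radR (a * b * a - a).
Proof.
move=> sa; have [c rc] := rad_regular K_noeth K_csl R_fg a.
have rs : radR (a * s c * a - a).
  rewrite (_ : _ - _ = s (- (a - a * c * a))); first exact/rad_invol/radN.
  by snc; rewrite sa; abel.
exists (h * (c + s c)); first by rewrite sM sh sD sK addrC hC.
rewrite (_ : _ - _ = h * (a * s c * a - a - (a - a * c * a))).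
  by apply: radMl; apply: radB.
rewrite -[X in _ - X = _](mul1r a) -h2 (mulrA a) -hC; ncring.
Qed.


(** * Isotropic vectors in the sum of a hyperbolic plane and e' R *)

Section HyperbolicForm.
Variables e' e'' : R.
Hypotheses (e'e' : e' * e' = e') (se' : s e' = e').
Local Notation triple := (R * R * R)%type.
Implicit Types (u v w : triple).

(* The orthogonal sum of a hyperbolic plane and the form given by s. *)
Definition hform u v : R := s u.1.1 * v.1.2 + s u.1.2 * v.1.1 + s u.2 * v.2.

(** The vector [j] spans the isometric copy of e'' orthogonal to [w], and [d] witnesses
    unimodularity. *)
Definition reach w : Prop :=
  [/\ hform w w = 0, e' * w.2 = w.2,
      exists j, [/\ e' * j.2 = j.2, hform w j = 0 & hform j j = e''] &
      exists2 d, e' * d.2 = d.2 & hform d w = 1].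

Lemma reach_isometry (g : triple -> triple) w :
  (forall u v, hform (g u) (g v) = hform u v) ->
  (forall u, e' * u.2 = u.2 -> e' * (g u).2 = (g u).2) ->
  reach w -> reach (g w).
Proof.
move=> gH ge [ww we [j [je wj jj]] [d de dw]]; split; rewrite ?gH //; first exact: ge.
  by exists (g j); rewrite !gH; split=> //; apply: ge.
by exists (g d); rewrite ?gH //; apply: ge.
Qed.

(** The Eichler transformation that fixes (1, 0, 0); prescribing k + s(k) is what makes it preserve
    [hform]. *)
Lemma reach_eichler f k p q m : s k = - k - f * e' * s f -> reach (p, q, m) ->
  reach (p + (f * e' * m + k * q), q, m - e' * s f * q).
Proof.
move=> sk; pose g u : triple :=
  (u.1.1 + (f * e' * u.2 + k * u.1.2), u.1.2, u.2 - e' * s f * u.1.2).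
apply: (@reach_isometry g (p, q, m)).
  move=> [[p1 q1] m1] [[p2 q2] m2]; rewrite /hform /g /=.
  by snc; rewrite sk se'; expand; rewrite -!(mulrA _ e' e') e'e'; abel.
by move=> [[p1 q1] m1] /= e'm; rewrite mulrBr e'm !mulrA e'e'.
Qed.

(** On the parts cut out by the idempotents t t' and t' t the two hyperbolic coordinates are
    exchanged through [t] and [t']; the complementary parts are fixed. *)
Lemma reach_swap t t' p q m : s t = t -> s t' = t' -> t * t' * t = t ->
  t' * t * t' = t' -> reach (p, q, m) ->
  reach (p + (t * q - t * t' * p), q - t' * t * q + t' * p, m).
Proof.
move=> st st' tt't t'tt'; pose g u : triple :=
  (u.1.1 + (t * u.1.2 - t * t' * u.1.1), u.1.2 - t' * t * u.1.2 + t' * u.1.1, u.2).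
apply: (@reach_isometry g (p, q, m)) => //.
have xtt x : x * t * t' * t = x * t by rewrite -!mulrA (mulrA t) tt't.
have xtt' x : x * t' * t * t' = x * t' by rewrite -!mulrA (mulrA t') t'tt'.
move=> [[p1 q1] m1] [[p2 q2] m2]; rewrite /hform /g /=.
by snc; rewrite st st' !(xtt, xtt'); abel.
Qed.

Section Minimal.
Variables p q m c l x : R.
Hypotheses (wreach : reach (p, q, m)) (rc : radR (p - p * c * p)).
Hypotheses (lE : l = 1 - p * c) (xE : x = 1 - c * p).
Hypothesis wmin : forall w, reach w ->
  (forall y, radR (w.1.1 * y) -> radR (p * y)) ->
  forall y, radR (p * y) -> radR (w.1.1 * y).

Lemma rad_px : radR (p * x).
Proof. by rewrite xE mulrBr mulr1 mulrA. Qed.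

Lemma rad_pcl y : radR (p * (c * (l * y))).
Proof.
rewrite !mulrA; apply: radMr.
by rewrite (_ : _ * _ = (p - p * c * p) * c); [apply: radMr|rewrite lE; ncring].
Qed.

(** Modulo the radical, [l] and [x] are idempotents generating the left and right annihilators of
    [p]. If p c d vanishes there, whatever p + d kills is killed by [p]; by minimality p + d then
    kills [x], and so does [d]. *)
Lemma reach_perturb d q' m' : reach (p + d, q', m') -> radR (p * c * d) ->
  radR (d * x).
Proof.
move=> wr rd; rewrite -(addKr (p * x) (d * x)) addrC -mulrDl.
apply: radB; last exact: rad_px.
apply: (wmin wr) => [y /= hy|]; last exact: rad_px.
rewrite (_ : p * y = (p - p * c * p) * y + p * c * ((p + d) * y) - p * c * d * y).
  by apply: radB; [apply: radD; [apply: radMr|apply: radMl]|apply: radMr].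
by ncring.
Qed.

Lemma perturb_skew y : s y = - y -> radR (l * y * s l * q * x).
Proof.
move=> sy; have := @reach_eichler 0 (l * y * s l) p q m _ wreach.
rewrite !mul0r subr0 add0r => /(_ _)/reach_perturb; apply; first by snc; rewrite sy; ncring.
by rewrite -!mulrA; exact: rad_pcl.
Qed.

(** Skew [y] came from an Eichler transformation with f = 0; for symmetric [y] a symmetric lift [t]
    of l y s(l), with its quasi-inverse, defines a partial swap. *)
Lemma perturb_symmetric y : s y = y -> radR (l * y * s l * q * x).
Proof.
move=> sy; pose a := l * y * s l.
have sa : s a = a by rewrite /a; snc; rewrite sy.
have [b sb rb] := rad_regular_symmetric sa.
have [t [t' [st st' tt't t'tt' rt]]] := symmetric_lift sa sb rb.
have dx : radR ((t * q - t * t' * p) * x).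
  apply: (reach_perturb (reach_swap st st' tt't t'tt' wreach)).
  rewrite (_ : _ * _ = p * c * ((t - a) * (q - t' * p)) + p * c * (a * (q - t' * p))).
    by apply: radD; [apply: radMl; apply: radMr|rewrite /a -!mulrA; apply: rad_pcl].
  by ncring.
rewrite -/a (_ : _ * x = (t * q - t * t' * p) * x + t * t' * (p * x) - (t - a) * (q * x)).
  by apply: radB; [apply: radD => //; apply/radMl/rad_px|apply: radMr].
by ncring.
Qed.

Lemma perturb_form y : radR (l * y * s l * q * x).
Proof.
apply: rad_double.
rewrite (_ : _ + _ = l * (y - s y) * s l * q * x + l * (y + s y) * s l * q * x).
  by apply: radD; [apply: perturb_skew|apply: perturb_symmetric]; snc; abel.
by ncring.
Qed.

(** The Eichler transformation with parameter l g adds to [p] a term in [m] linear in [g] and a term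
    in [q] quadratic in [g]. Subtracting the cases g = f and g = - f isolates twice the former. *)
Lemma perturb_third f : radR (l * f * e' * m * x).
Proof.
have pert g : radR ((l * g * e' * m - h * (l * g * e' * s g * s l) * q) * x).
  pose X := l * g * e' * s g * s l.
  have sX : s X = X by rewrite /X; snc; rewrite se'.
  rewrite -/X; have := @reach_eichler (l * g) (- (h * X)) p q m _ wreach.
  rewrite mulNr => /(_ _)/reach_perturb; apply.
    rewrite (_ : _ * s (l * g) = X); last by rewrite sM mulrA.
    by rewrite involN sM sX sh -hC opprK -[X in _ = _ - X](mul1r X) -h2; ncring.
  rewrite mulrBr; apply: radB; first by rewrite -!mulrA; apply: rad_pcl.
  rewrite -(mulrA h) (mulrA (p * c)) -hC -(mulrA h); apply: radMl.
  by rewrite -!mulrA; apply: rad_pcl.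
apply: rad_double.
rewrite (_ : _ + _ = (l * f * e' * m - h * (l * f * e' * s f * s l) * q) * x -
   (l * (- f) * e' * m - h * (l * (- f) * e' * s (- f) * s l) * q) * x).
  exact: radB.
by snc; abel.
Qed.

(** Unimodularity writes [1] as a left combination of [p], [q] and [m]. The term in [p] dies on [x],
    the term in [m] by [perturb_third]. For the term in [q], z = z s(l) + z s(c) s(p), and isotropy
    rewrites s(p) q in terms of [p] and [m]. *)
Lemma perturb_left y : radR (l * y * x).
Proof.
have [ww /= we _ [d /= de]] := wreach; rewrite /hform /= in ww * => dw.
rewrite (_ : _ * x = l * y * (s d.1.1 * q + s d.1.2 * p + s d.2 * m) * x); last first.
  by rewrite dw mulr1.
rewrite -de -we; set z := y * s d.1.1.
have lzqx : radR (l * z * q * x).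
  rewrite (_ : _ * x = l * z * s l * q * x - l * z * s c * s q * (p * x)
      - l * (z * s c * s m) * e' * m * x + l * z * s c * (s p * q + s q * p + s m * m) * x).
    rewrite ww mulr0 mul0r addr0; apply: radB; last exact: perturb_third.
    by apply: radB; [apply: perturb_form|apply/radMl/rad_px].
  by rewrite -(mulrA _ e' m) we lE; snc; abel.
rewrite (_ : _ * x = l * z * q * x + l * y * s d.1.2 * (p * x)
    + l * (y * s d.2) * e' * m * x).
  apply: radD; last exact: perturb_third.
  by apply: radD => //; apply/radMl/rad_px.
by rewrite /z; snc; rewrite se' -(mulrA _ e' e') e'e'; abel.
Qed.

(** Modulo the radical l R x = 0, so p c is the identity on R x and p^n c^n x = x. Thus p^(n+1)
    kills c^n x; as the kernels [f n] stabilise, p^n kills it too, so x = 0 and c p = 1 there. *)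
Lemma minimal_unit : exists2 z, p * z = 1 & z * p = 1.
Proof.
suff rx : radR x.
  have [z hz _] := rad_unit K_noeth R_fg rx; rewrite xE subKr mulrA in hz.
  by exists (z * c) => //; apply: (fg_dedekind_finite K_noeth R_fg).
have srad := @submodule_rad K R.
pose f n : set R := [set v | (forall y, radR (l * y * v)) /\ radR (p ^+ n * v)].
have [||n fn] := fg_chain_stable K_noeth R_fg (f := f).
- move=> n; split=> [|u v [hu pu] [hv pv]|k u [hu pu]]; (split=> [y|] /=).
  + by rewrite mulr0; apply: rad0.
  + by rewrite mulr0; apply: rad0.
  + by rewrite mulrDr; apply: radD.
  + by rewrite mulrDr; apply: radD.
  + by rewrite -scalerAr; apply: (submoduleZ k srad).
  + by rewrite -scalerAr; apply: (submoduleZ k srad).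
- by move=> n v [hv pv]; split=> //; rewrite exprS -mulrA; apply: radMl.
have cx i y : radR (l * y * (c ^+ i * x)).
  by rewrite mulrA -(mulrA l); apply: perturb_left.
have pcx i : radR (x - p ^+ i * (c ^+ i * x)).
  elim: i => [|i IH]; first by rewrite !mul1r subrr; apply: rad0.
  rewrite (_ : _ - _ = (x - p ^+ i * (c ^+ i * x)) + p ^+ i * (l * 1 * (c ^+ i * x))).
    by apply: radD => //; apply: radMl.
  by rewrite lE exprSr exprS; ncring.
have : f n.+1 (c ^+ n * x).
  split=> //; rewrite exprS -mulrA (_ : _ * _ = p * x - p * (x - p ^+ n * (c ^+ n * x))).
    by apply: radB; [apply: rad_px|apply: radMl].
  by ncring.
rewrite fn => -[_ h1]; rewrite -(subrK (p ^+ n * (c ^+ n * x)) x).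
exact: radD.
Qed.

End Minimal.
Lemma reach_unit w : reach w ->
  exists p q m, reach (p, q, m) /\ exists2 z, p * z = 1 & z * p = 1.
Proof.
move=> rw.
have [||_ [[[p q] m] wr <-] wmin] := fg_dcc K_noeth (proj1 K_csl) R_fg
  (F := (fun w : triple => [set v | radR (w.1.1 * v)]) @` reach).
- by exists [set v | radR (w.1.1 * v)], w.
- move=> _ [u _ <-]; split=> //; first exact: (submodule_mull _ (@submodule_rad K R)).
  move=> k v Jk _ /=; apply: radMl; apply: (set_scale_Jac_rad K_noeth R_fg).
  exact: set_scaleZ.
have [c rc] := rad_regular K_noeth K_csl R_fg p.
exists p, q, m; split=> //; apply: (minimal_unit wr rc erefl erefl) => u ru hu y hy.
suff : [set v | radR (u.1.1 * v)] y by [].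
by rewrite (wmin [set v | radR (u.1.1 * v)]) //; exists u.
Qed.

Lemma reach_embedding w : reach w -> exists2 t, e' * t = t & s t * t = e''.
Proof.
case/reach_unit=> p [q [m [[ww /= em [[[a b] n] /= [en wj jj]] _] [z pz zp]]]].
rewrite /hform /= in ww wj jj.
(* The third coordinate of j - w z a. Its first coordinate vanishes because z = p^-1, so its norm is
   that of the third one; it is also the norm of [j], as [w] is isotropic and orthogonal to [j]. *)
exists (n - m * z * a); first by rewrite mulrBr en !mulrA em.
have szp : s z * s p = 1 by rewrite -sM pz invol1.
have mm : s m * m = - (s p * q + s q * p).
  by apply/eqP; rewrite -addr_eq0 addrC ww.
have mn : s m * n = - (s p * b + s q * a).
  by apply/eqP; rewrite -addr_eq0 addrC wj.
have nm : s n * m = - (s b * p + s a * q) by rewrite -[LHS]sK sM sK mn; snc.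
have -> : s (n - m * z * a) * (n - m * z * a) = s n * n - (s n * m) * z * a
    - s a * s z * (s m * n) + s a * s z * (s m * m) * z * a by snc; abel.
rewrite mm mn nm -jj; expand.
rewrite -!(mulrA _ (s z) (s p)) szp -!(mulrA _ p z) pz; expand; abel.
Qed.

End HyperbolicForm.

Lemma cancel_embedding e1 e1' e2 e2' u t :
  e1 * e1 = e1 -> s e1 = e1 -> e1' * e1' = e1' -> s e1' = e1' ->
  e2 * e2 = e2 -> s e2 = e2 -> e2' * e2' = e2' -> s e2' = e2' ->
  e1 * e1' = 0 -> e2 * e2' = 0 -> s u * u = e1 -> e2 * u = u -> u * e1 = u ->
  s t * t = e1 + e1' -> t * s t = e2 + e2' ->
  exists2 v, e1' * v = v & s v * v = e2'.
Proof.
move=> ee1 se1 ee1' se1' ee2 se2 ee2' se2' e11' e22' uu eu ue tt' tt.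
have e22'' : e2' * e2 = 0 by rewrite -se2 -se2' -sM e22' invol0.
(* The components of s(t) u along e1 and e1', the first completed by 1 - e1, form a vector (a, m) of
   norm 1. Those of s(t) e2' form an orthogonal vector (b, n) of norm e2'. *)
pose a := e1 * s t * u + (1 - e1); pose m := e1' * s t * u.
pose b := e1 * s t * e2'; pose n := e1' * s t * e2'.
have tet : t * (e1 + e1') * s t = e2 + e2'.
  rewrite -tt' mulrA -(mulrA _ t) tt; expand.
  by rewrite ee2 ee2' e22' e22''; abel.
have e2'u : e2' * u = 0 by rewrite -eu mulrA e22'' mul0r.
have c1 : e1 * (1 - e1) = 0 by rewrite mulrBr mulr1 ee1 subrr.
have c2 : (1 - e1) * e1 = 0 by rewrite mulrBl mul1r ee1 subrr.
have c3 : (1 - e1) * (1 - e1) = 1 - e1 by rewrite mulrBr c2 mulr1 subr0.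
have aa : s a * a + s m * m = 1.
  rewrite (_ : _ + _ = s u * (t * (e1 * e1 + e1' * e1') * s t) * u
      + s u * t * (e1 * (1 - e1)) + (1 - e1) * e1 * s t * u + (1 - e1) * (1 - e1)).
    rewrite ee1 ee1' tet c1 c2 c3 mulr0 !mul0r -mulrA mulrDl eu e2'u !addr0 uu.
    by abel.
  by rewrite /a /m; snc; rewrite se1 se1'; abel.
have ab : s a * b + s m * n = 0.
  rewrite (_ : _ + _ = s u * (t * (e1 * e1 + e1' * e1') * s t) * e2'
      + (1 - e1) * e1 * s t * e2').
    rewrite ee1 ee1' tet c2 !mul0r -mulrA mulrDl e22' ee2' add0r !addr0.
    by rewrite -[LHS]sK sM sK se2' e2'u invol0.
  by rewrite /a /b /m /n; snc; rewrite se1 se1'; abel.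
have bb : s b * b + s n * n = e2'.
  rewrite (_ : _ + _ = e2' * (t * (e1 * e1 + e1' * e1') * s t) * e2').
    by rewrite ee1 ee1' tet mulrDr e22'' add0r !ee2'.
  by rewrite /b /n; snc; rewrite se1 se1' se2'; abel.
clearbody a b.
(* The coordinates h (x + y) and x - y turn s(x) x - s(y) y into the hyperbolic form. The vector [w]
   has x = a, y = 1, and [j] has x = b, y = 0. *)
apply: (@reach_embedding e1' e2' ee1' se1' (h * (1 + a), a - 1, m)); split.
- rewrite /hform /= (_ : _ + _ = s a * (h + h) * a - (h + h) + s m * m).
    by rewrite h2 mulr1 addrAC aa subrr.
  by snc; abel.
- by rewrite /= /m !mulrA ee1'.
- exists (h * b, b, n); rewrite /hform /=; split.
  + by rewrite /n !mulrA ee1'.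
  + rewrite (_ : _ + _ = s a * (h + h) * b + s m * n); first by rewrite h2 mulr1.
    by snc; abel.
  + rewrite (_ : _ + _ = s b * (h + h) * b + s n * n); first by rewrite h2 mulr1.
    by snc; abel.
- exists (- h, 1, 0); rewrite /hform /= ?mulr0 //.
  by rewrite -[RHS]h2; snc; abel.
Qed.

(** The composite x = u1 v1 embeds [e] isometrically in itself, so x + (1 - e) has a left inverse.
    Dedekind finiteness makes it invertible, hence u1 is onto [e]. *)
Lemma embedding_antisym e f u v : e * e = e -> s e = e -> f * f = f -> s f = f ->
  e * u = u -> s u * u = f -> f * v = v -> s v * v = e ->
  exists2 t, s t * t = e /\ t * s t = f & f * t = t /\ t * e = t.
Proof.
move=> ee se ff sf eu uu fv vv.
pose u1 := u * f; pose v1 := v * e.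
have uu1 : s u1 * u1 = f by rewrite /u1 sM sf -mulrA (mulrA (s u)) uu !ff.
have vv1 : s v1 * v1 = e by rewrite /v1 sM se -mulrA (mulrA (s v)) vv !ee.
have eu1 : e * u1 = u1 by rewrite /u1 mulrA eu.
have uf1 : u1 * f = u1 by rewrite /u1 -mulrA ff.
have fv1 : f * v1 = v1 by rewrite /v1 mulrA fv.
have ve1 : v1 * e = v1 by rewrite /v1 -mulrA ee.
clearbody u1 v1.
have [x xE] : exists x, x = u1 * v1 by exists (u1 * v1).
have xx : s x * x = e by rewrite xE sM -mulrA (mulrA (s u1)) uu1 fv1 vv1.
have ex : e * x = x by rewrite xE mulrA eu1.
have xe : x * e = x by rewrite xE -mulrA ve1.
have sxe : s x * e = s x by rewrite -se -sM ex.
have esx : e * s x = s x by rewrite -se -sM xe.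
have xsx : x * s x = e.
  have : (s x + (1 - e)) * (x + (1 - e)) = 1.
    by expand; rewrite xx sxe ex ee; abel.
  move/(fg_dedekind_finite K_noeth R_fg); expand; rewrite xe esx ee => h1.
  by rewrite -[RHS](subKr 1) -[X in _ = X - _]h1; abel.
have u1su : u1 * s u1 = e.
  have : u1 * s u1 * (x * s x) = e.
    by rewrite -xsx xE sM !mulrA -(mulrA u1) uu1 uf1.
  have su1e : s u1 * e = s u1 by rewrite -{1}se -sM eu1.
  by rewrite xsx -mulrA su1e.
exists (s u1); rewrite ?sK //; split=> //.
  by rewrite -sf -sM uf1.
by rewrite -se -sM eu1.
Qed.

Lemma partial_isometry_cancel e1 e1' e2 e2' u t :
  e1 * e1 = e1 -> s e1 = e1 -> e1' * e1' = e1' -> s e1' = e1' ->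
  e2 * e2 = e2 -> s e2 = e2 -> e2' * e2' = e2' -> s e2' = e2' ->
  e1 * e1' = 0 -> e2 * e2' = 0 ->
  s u * u = e1 -> u * s u = e2 -> e2 * u = u -> u * e1 = u ->
  s t * t = e1 + e1' -> t * s t = e2 + e2' ->
  exists2 v, s v * v = e1' /\ v * s v = e2' & e2' * v = v /\ v * e1' = v.
Proof.
move=> ee1 se1 ee1' se1' ee2 se2 ee2' se2' e11' e22' uu uu' eu ue tt tt'.
have [v ev vv] := cancel_embedding ee1 se1 ee1' se1' ee2 se2 ee2' se2' e11' e22'
  uu eu ue tt tt'.
have [|||||w ew ww] := @cancel_embedding e2 e2' e1 e1' (s u) (s t) ee2 se2 ee2' se2'
  ee1 se1 ee1' se1' e22' e11'; rewrite ?sK //.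
- by rewrite -se1 -sM ue.
- by rewrite -se2 -sM eu.
exact: (embedding_antisym ee1' se1' ee2' se2' ev vv ew ww).
Qed.

End InvolutiveAlgebras.

(** * Finite generation of products and of embedded modules *)

Section FinitelyGenerated.
Variable K : comPzRingType.
Implicit Types V W : lmodType K.

Lemma span_finitely_generated V (s : seq V) :
  (forall v, span s v) -> finitely_generated (setT : set V).
Proof.
by move=> hs; exists s; apply/esym/seteqP; split=> // v _; apply/span_coefs.
Qed.

Lemma finitely_generated_prod V W : finitely_generated (setT : set V) ->
  finitely_generated (setT : set W) -> finitely_generated (setT : set (V * W)%type).
Proof.
move=> /finitely_generated_span[s hs] /finitely_generated_span[t ht].
pose r : seq (V * W)%type := [seq (x, 0) | x <- s] ++ [seq (0, y) | y <- t].
apply: (@span_finitely_generated _ r) => -[x y].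
have sr := submodule_span r.
rewrite (_ : (x, y) = (x, 0) + (0, y)); last first.
  by congr pair; rewrite /= ?addr0 ?add0r.
apply: (submoduleD sr).
  have : span s x by rewrite -hs.
  apply: (@span_min _ _ [set x | span r (x, 0)]).
    split=> [|a b ha hb|k a ha] /=; first exact: (submodule0 sr).
      rewrite (_ : (a + b, 0) = (a, 0) + (b, 0)); first exact: (submoduleD sr).
      by congr pair; rewrite /= addr0.
    rewrite (_ : (k *: a, 0) = k *: (a, 0)); first exact: (submoduleZ k sr).
    by congr pair; rewrite /= scaler0.
  by move=> i; apply: mem_span; rewrite mem_cat map_f // mem_nth.
have : span t y by rewrite -ht.
apply: (@span_min _ _ [set y | span r (0, y)]).
  split=> [|a b ha hb|k a ha] /=; first exact: (submodule0 sr).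
    rewrite (_ : (0, a + b) = (0, a) + (0, b)); first exact: (submoduleD sr).
    by congr pair; rewrite /= addr0.
  rewrite (_ : (0, k *: a) = k *: (0, a)); first exact: (submoduleZ k sr).
  by congr pair; rewrite /= scaler0.
by move=> i; apply: mem_span; rewrite mem_cat orbC map_f // mem_nth.
Qed.

Lemma span_map_inj V W (f : W -> V) s w : linear f -> injective f ->
  span (map f s) (f w) -> span s w.
Proof.
move=> fl fi; have f0 : f 0 = 0.
  by have := fl (-1) 0 0; rewrite scaler0 addr0 scaleN1r addNr.
have fB k a b : f (a - k *: b) = f a - k *: f b.
  by have := fl (- k) b a; rewrite !scaleNr !(addrC (- _)).
elim: s w => [|x s IH] w /=; first by rewrite -f0 => /fi.
by case=> k; rewrite -fB => /IH h; exists k.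
Qed.

(** A list whose image has maximal span already generates: adjoining another element does not
    enlarge that span. *)
Lemma finitely_generated_embedding V W (f : W -> V) : noetherian K ->
  linear f -> injective f ->
  finitely_generated (setT : set V) -> finitely_generated (setT : set W).
Proof.
move=> K_noeth fl fi V_fg.
have [||_ [s _ <-] smax] := fg_acc K_noeth V_fg (F := range (fun s => span (map f s))).
- by exists (span (map f [::])), [::].
- by move=> _ [s _ <-]; split=> //; apply: submodule_span.
apply: (@span_finitely_generated _ s) => w; apply: (span_map_inj fl fi).
rewrite -(smax (span (map f (w :: s)))) /=; first exact: span_head.
  by exists (w :: s).
exact: span_cons.
Qed.

End FinitelyGenerated.

Local Notation "g \c f" := (kcomp g f) (at level 40, left associativity).

(** * Adjoint pairs of morphisms between systems of forms *)

Section Systems.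
Variables (K : comPzRingType) (C : kcategory K) (I : Type).
Variable H : I -> hermitian_structure C.
Local Notation hom := (@khom K C).
Implicit Types (X Y Z : C) (S T U : sesq_system H).

Lemma kcompDl X Y Z (g g' : hom Y Z) (f : hom X Y) : (g + g') \c f = g \c f + g' \c f.
Proof. by have := kcomp_linearl f 1 g g'; rewrite !scale1r. Qed.

Lemma kcompDr X Y Z (g : hom Y Z) (f f' : hom X Y) : g \c (f + f') = g \c f + g \c f'.
Proof. by have := kcomp_linearr g 1 f f'; rewrite !scale1r. Qed.

Lemma kcomp0l X Y Z (f : hom X Y) : (0 : hom Y Z) \c f = 0.
Proof. by apply: (addrI (0 \c f)); rewrite -kcompDl !addr0. Qed.

Lemma kcomp0r X Y Z (g : hom Y Z) : g \c (0 : hom X Y) = 0.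
Proof. by apply: (addrI (g \c 0)); rewrite -kcompDr !addr0. Qed.

Lemma kcompZl X Y Z k (g : hom Y Z) (f : hom X Y) : (k *: g) \c f = k *: (g \c f).
Proof. by have := kcomp_linearl f k g 0; rewrite kcomp0l !addr0. Qed.

Lemma kcompZr X Y Z k (g : hom Y Z) (f : hom X Y) : g \c (k *: f) = k *: (g \c f).
Proof. by have := kcomp_linearr g k f 0; rewrite kcomp0r !addr0. Qed.

Lemma kpr1_in1K X Y Z (f : hom Z X) : kpr1 X Y \c (kin1 X Y \c f) = f.
Proof. by rewrite kcompA kpr1_in1 kcomp_idl. Qed.

Lemma kpr2_in2K X Y Z (f : hom Z Y) : kpr2 X Y \c (kin2 X Y \c f) = f.
Proof. by rewrite kcompA kpr2_in2 kcomp_idl. Qed.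

Lemma kpr1_in2K X Y Z (f : hom Z Y) : kpr1 X Y \c (kin2 X Y \c f) = 0.
Proof. by rewrite kcompA kpr1_in2 kcomp0l. Qed.

Lemma kpr2_in1K X Y Z (f : hom Z X) : kpr2 X Y \c (kin1 X Y \c f) = 0.
Proof. by rewrite kcompA kpr2_in1 kcomp0l. Qed.

Definition ksumK := (kpr1_in1K, kpr2_in2K, kpr1_in2K, kpr2_in1K,
  kpr1_in1, kpr2_in2, kpr1_in2, kpr2_in1).

Lemma hdualm0 i X Y : hdualm (H i) (0 : hom X Y) = 0.
Proof. by apply: (addrI (hdualm (H i) 0)); rewrite -hdualm_add !addr0. Qed.

(** The forms may be degenerate, so an adjoint need neither exist nor be unique; it is carried along
    as data, one for all forms at once. Two equations are imposed since the forms have no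
    symmetry. *)
Definition adjoint S T (u : hom (sys_ob S) (sys_ob T)) (v : hom (sys_ob T) (sys_ob S)) :=
  forall i, sys_form T i \c u = hdualm (H i) v \c sys_form S i /\
            sys_form S i \c v = hdualm (H i) u \c sys_form T i.

Lemma adjoint_sym S T u v : @adjoint S T u v -> @adjoint T S v u.
Proof. by move=> a i; have [a1 a2] := a i. Qed.

Lemma adjoint_id S : adjoint (kid (sys_ob S)) (kid (sys_ob S)).
Proof. by move=> i; rewrite hdualm_id kcomp_idl kcomp_idr. Qed.

Lemma adjoint_comp S T U u v u' v' : @adjoint S T u v -> @adjoint T U u' v' ->
  adjoint (u' \c u) (v \c v').
Proof.
move=> a b i; have [a1 a2] := a i; have [b1 b2] := b i.
by rewrite !hdualm_comp -!kcompA -a1 -b2 !kcompA b1 a2.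
Qed.

Lemma adjointD S T u v u' v' : @adjoint S T u v -> @adjoint S T u' v' ->
  adjoint (u + u') (v + v').
Proof.
move=> a b i; have [a1 a2] := a i; have [b1 b2] := b i.
by rewrite !hdualm_add !kcompDl !kcompDr a1 a2 b1 b2.
Qed.

Lemma adjoint0 S T : @adjoint S T 0 0.
Proof. by move=> i; rewrite !hdualm0 !kcomp0l !kcomp0r. Qed.

Lemma adjoint_isometry S T (f : hom (sys_ob S) (sys_ob T)) g :
  g \c f = kid _ -> f \c g = kid _ ->
  adjoint f g <-> forall i, hdualm (H i) f \c (sys_form T i \c f) = sys_form S i.
Proof.
move=> gf fg; split=> [a i|fi i].
  by have [_ a2] := a i; rewrite kcompA -a2 -kcompA gf kcomp_idr.
rewrite -fi; split.
  by rewrite kcompA -hdualm_comp fg hdualm_id kcomp_idl.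
by rewrite -!kcompA fg kcomp_idr.
Qed.

Lemma isometricP S T : isometric S T <->
  exists f g, [/\ @adjoint S T f g, g \c f = kid _ & f \c g = kid _].
Proof.
split=> [[f [[g [gf fg]] fi]]|[f [g [a gf fg]]]].
  by exists f, g; split=> //; apply/(adjoint_isometry gf fg).
by exists f; split; [exists g|apply/(adjoint_isometry gf fg)].
Qed.

Lemma orth_sum_form S T i : sys_form (orth_sum S T) i =
  hdualm (H i) (kpr1 _ _) \c (sys_form S i \c kpr1 _ _) +
  hdualm (H i) (kpr2 _ _) \c (sys_form T i \c kpr2 _ _).
Proof.
rewrite /= /hdual_ksum /ksum_map kcompDl !kcompDr -!kcompA.
by rewrite !ksumK !kcomp0r addr0 add0r.
Qed.

Lemma adjoint_in1 S T : @adjoint S (orth_sum S T) (kin1 _ _) (kpr1 _ _).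
Proof.
move=> i; rewrite orth_sum_form !kcompDl !kcompDr -!kcompA kpr1_in1 kpr2_in1.
rewrite !kcomp0r kcomp_idr addr0; split=> //.
rewrite !(kcompA (hdualm _ (kin1 _ _))) -!hdualm_comp kpr1_in1 kpr2_in1.
by rewrite hdualm0 hdualm_id kcomp_idl kcomp0l addr0.
Qed.

Lemma adjoint_in2 S T : @adjoint T (orth_sum S T) (kin2 _ _) (kpr2 _ _).
Proof.
move=> i; rewrite orth_sum_form !kcompDl !kcompDr -!kcompA kpr2_in2 kpr1_in2.
rewrite !kcomp0r kcomp_idr add0r; split=> //.
rewrite !(kcompA (hdualm _ (kin2 _ _))) -!hdualm_comp kpr2_in2 kpr1_in2.
by rewrite hdualm0 hdualm_id kcomp_idl kcomp0l add0r.
Qed.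

End Systems.

(** * The algebra of adjoint pairs of endomorphisms *)

Section AdjointablePairs.
Variables (K : comPzRingType) (C : kcategory K) (I : Type).
Variable H : I -> hermitian_structure C.
Hypothesis H_klinear : forall i, klinear_structure (H i).
Variable S : sesq_system H.
Local Notation Q := (sys_ob S).
Hypothesis Q_nz : kid Q <> 0.

(** Second components will multiply in the opposite order, which makes swapping an involution.
    [Q_nz] separates [1] from [0] in the ring instance. *)
Record adjpair := AdjPair {
  adj1 : khom Q Q;
  adj2 : khom Q Q;
  adjP : adjoint adj1 adj2
}.

Lemma adjpair_ext (x y : adjpair) : adj1 x = adj1 y -> adj2 x = adj2 y -> x = y.
Proof.
case: x y => [u v p] [u' v' p'] /= eu ev; move: p p'; rewrite eu ev => p p'.
by rewrite (Prop_irrelevance p p').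
Qed.

Lemma adjointZ k (u v : khom Q Q) : adjoint u v -> adjoint (k *: u) (k *: v).
Proof.
have dZ i (w : khom Q Q) : hdualm (H i) (k *: w) = k *: hdualm (H i) w.
  by have := H_klinear i k w 0; rewrite hdualm0 !addr0.
by move=> a i; have [a1 a2] := a i; rewrite !dZ !kcompZl !kcompZr a1 a2.
Qed.

Lemma adjointN (u v : khom Q Q) : adjoint u v -> adjoint (- u) (- v).
Proof. by rewrite -!(scaleN1r (_ : khom Q Q)); apply: adjointZ. Qed.

HB.instance Definition _ := gen_eqMixin adjpair.
HB.instance Definition _ := gen_choiceMixin adjpair.

Let add x y := AdjPair (adjointD (adjP x) (adjP y)).
Let opp x := AdjPair (adjointN (adjP x)).
Let zero := AdjPair (adjoint0 S S).
Let mul x y := AdjPair (adjoint_comp (adjP y) (adjP x)).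
Let one := AdjPair (adjoint_id S).
Let scale k x := AdjPair (adjointZ k (adjP x)).

Fact adjpair_addA : associative add.
Proof. by move=> x y z; apply: adjpair_ext; rewrite /= addrA. Qed.
Fact adjpair_addC : commutative add.
Proof. by move=> x y; apply: adjpair_ext; rewrite /= addrC. Qed.
Fact adjpair_add0 : left_id zero add.
Proof. by move=> x; apply: adjpair_ext; rewrite /= add0r. Qed.
Fact adjpair_addN : left_inverse zero opp add.
Proof. by move=> x; apply: adjpair_ext; rewrite /= addNr. Qed.
HB.instance Definition _ :=
  GRing.isZmodule.Build adjpair adjpair_addA adjpair_addC adjpair_add0 adjpair_addN.

Fact adjpair_mulA : associative mul.
Proof. by move=> x y z; apply: adjpair_ext; rewrite /= kcompA. Qed.
Fact adjpair_mul1 : left_id one mul.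
Proof. by move=> x; apply: adjpair_ext; rewrite /= ?kcomp_idl ?kcomp_idr. Qed.
Fact adjpair_mulr1 : right_id one mul.
Proof. by move=> x; apply: adjpair_ext; rewrite /= ?kcomp_idl ?kcomp_idr. Qed.
Fact adjpair_mulDl : left_distributive mul +%R.
Proof. by move=> x y z; apply: adjpair_ext; rewrite /= ?kcompDl ?kcompDr. Qed.
Fact adjpair_mulDr : right_distributive mul +%R.
Proof. by move=> x y z; apply: adjpair_ext; rewrite /= ?kcompDl ?kcompDr. Qed.
Fact adjpair_one_neq0 : one != 0.
Proof. by apply/eqP => /(congr1 adj1). Qed.
HB.instance Definition _ := GRing.Zmodule_isNzRing.Build adjpair adjpair_mulA
  adjpair_mul1 adjpair_mulr1 adjpair_mulDl adjpair_mulDr adjpair_one_neq0.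

Fact adjpair_scaleA k l x : scale k (scale l x) = scale (k * l) x.
Proof. by apply: adjpair_ext; rewrite /= scalerA. Qed.
Fact adjpair_scale1 : left_id 1 scale.
Proof. by move=> x; apply: adjpair_ext; rewrite /= scale1r. Qed.
Fact adjpair_scaleDr : right_distributive scale +%R.
Proof. by move=> k x y; apply: adjpair_ext; rewrite /= scalerDr. Qed.
Fact adjpair_scaleDl x : {morph scale^~ x : k l / k + l}.
Proof. by move=> k l; apply: adjpair_ext; rewrite /= scalerDl. Qed.
HB.instance Definition _ := GRing.Zmodule_isLmodule.Build K adjpair adjpair_scaleA
  adjpair_scale1 adjpair_scaleDr adjpair_scaleDl.

Fact adjpair_scaleAl k (x y : adjpair) : k *: (x * y) = k *: x * y.
Proof. by apply: adjpair_ext; rewrite /= ?kcompZl ?kcompZr. Qed.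
HB.instance Definition _ := GRing.Lmodule_isLalgebra.Build K adjpair adjpair_scaleAl.

Fact adjpair_scaleAr k (x y : adjpair) : k *: (x * y) = x * (k *: y).
Proof. by apply: adjpair_ext; rewrite /= ?kcompZl ?kcompZr. Qed.
HB.instance Definition _ := GRing.Lalgebra_isAlgebra.Build K adjpair adjpair_scaleAr.

Definition adjswap (x : adjpair) : adjpair := AdjPair (adjoint_sym (adjP x)).

Lemma adjpair_fg : noetherian K ->
  finitely_generated (setT : set (khom Q Q)) ->
  finitely_generated (setT : set adjpair).
Proof.
move=> K_noeth fg.
apply: (@finitely_generated_embedding K _ _
  (fun x : adjpair => (adj1 x, adj2 x) : (khom Q Q * khom Q Q)%type)) => //.
- by move=> x y [] /= e1 e2; apply: adjpair_ext.
- exact: finitely_generated_prod.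
Qed.

Lemma adjpair_cancel (K_noeth : noetherian K) (K_csl : complete_semilocal K)
  (two_inv : exists u : K, (u * 2%:R = 1)%R)
  (fg : finitely_generated (setT : set (khom Q Q))) (e1 e1' e2 e2' u t : adjpair) :
  e1 * e1 = e1 -> adjswap e1 = e1 -> e1' * e1' = e1' -> adjswap e1' = e1' ->
  e2 * e2 = e2 -> adjswap e2 = e2 -> e2' * e2' = e2' -> adjswap e2' = e2' ->
  e1 * e1' = 0 -> e2 * e2' = 0 ->
  adjswap u * u = e1 -> u * adjswap u = e2 -> e2 * u = u -> u * e1 = u ->
  adjswap t * t = e1 + e1' -> t * adjswap t = e2 + e2' ->
  exists2 v, adjswap v * v = e1' /\ v * adjswap v = e2' & e2' * v = v /\ v * e1' = v.
Proof.
have [h hE] := two_inv; have R_fg := adjpair_fg K_noeth fg.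
apply: (@partial_isometry_cancel K K_noeth K_csl _ R_fg adjswap _ _ _ _ h%:A).
- by move=> x y; apply: adjpair_ext.
- by move=> x y; apply: adjpair_ext.
- by move=> x; apply: adjpair_ext.
- by move=> k x; apply: adjpair_ext.
- by rewrite -scalerDl -[X in X + _]mulr1 -[X in _ + X]mulr1 -mulrDr hE scale1r.
- exact: adjpair_ext.
- by move=> x; rewrite -scalerAl -scalerAr mul1r mulr1.
Qed.

(** Each retraction (i, p) gives a self-adjoint idempotent i p. The pair (i2 p1, i1 p2) is the
    partial isometry between the two copies of [M], and (f, g) the one between the two orthogonal
    sums. *)
Lemma orthogonal_complement_cancel (K_noeth : noetherian K)
  (K_csl : complete_semilocal K) (two_inv : exists u : K, (u * 2%:R = 1)%R)
  (fg : finitely_generated (setT : set (khom Q Q))) (M M' M'' : sesq_system H)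
  i1 p1 i1' p1' i2 p2 i2' p2' f g :
  @adjoint _ _ _ _ M S i1 p1 -> @adjoint _ _ _ _ M' S i1' p1' ->
  @adjoint _ _ _ _ M S i2 p2 -> @adjoint _ _ _ _ M'' S i2' p2' ->
  @adjoint _ _ _ _ S S f g ->
  p1 \c i1 = kid _ -> p1' \c i1' = kid _ -> p1 \c i1' = 0 -> p1' \c i1 = 0 ->
  p2 \c i2 = kid _ -> p2' \c i2' = kid _ -> p2 \c i2' = 0 -> p2' \c i2 = 0 ->
  g \c f = i1 \c p1 + i1' \c p1' -> f \c g = i2 \c p2 + i2' \c p2' ->
  isometric M' M''.
Proof.
move=> a1 a1' a2 a2' af h1 h1' o1 o1' h2 h2' o2 o2' gf fg'.
pose e1 := AdjPair (adjoint_comp (adjoint_sym a1) a1).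
pose e1' := AdjPair (adjoint_comp (adjoint_sym a1') a1').
pose e2 := AdjPair (adjoint_comp (adjoint_sym a2) a2).
pose e2' := AdjPair (adjoint_comp (adjoint_sym a2') a2').
pose u := AdjPair (adjoint_comp (adjoint_sym a1) a2).
have k1 Z (x : khom Z _) : p1 \c (i1 \c x) = x by rewrite kcompA h1 kcomp_idl.
have k1' Z (x : khom Z _) : p1' \c (i1' \c x) = x by rewrite kcompA h1' kcomp_idl.
have k2 Z (x : khom Z _) : p2 \c (i2 \c x) = x by rewrite kcompA h2 kcomp_idl.
have k2' Z (x : khom Z _) : p2' \c (i2' \c x) = x by rewrite kcompA h2' kcomp_idl.
have z1 Z (x : khom Z _) : p1 \c (i1' \c x) = 0 by rewrite kcompA o1 kcomp0l.
have z2 Z (x : khom Z _) : p2 \c (i2' \c x) = 0 by rewrite kcompA o2 kcomp0l.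
have z1' Z (x : khom Z _) : p1' \c (i1 \c x) = 0 by rewrite kcompA o1' kcomp0l.
have z2' Z (x : khom Z _) : p2' \c (i2 \c x) = 0 by rewrite kcompA o2' kcomp0l.
have [||||||||||||||||v [vv vv'] [ev ve]] := @adjpair_cancel K_noeth K_csl two_inv fg
  e1 e1' e2 e2' u (AdjPair af);
  try by apply: adjpair_ext => //=;
         rewrite -!kcompA ?(k1, k1', k2, k2', z1, z1', z2, z2') ?kcomp0r.
apply/isometricP; exists (p2' \c (adj1 v \c i1')), (p1' \c adj2 v \c i2').
move/(congr1 adj1): vv => /= vv; move/(congr1 adj1): vv' => /= vv'.
move/(congr1 adj1): ev => /= ev; move/(congr1 adj2): ve => /= ve.
split.
- apply: adjoint_comp (adjoint_sym a2'); apply: adjoint_comp (adjP v); exact: a1'.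
- rewrite -!kcompA (_ : i2' \c _ = adj1 v \c i1'); last by rewrite !kcompA ev.
  by rewrite (kcompA (adj2 v)) vv -kcompA k1' h1'.
- rewrite -!kcompA (_ : i1' \c _ = adj2 v \c i2'); last by rewrite !kcompA ve.
  by rewrite (kcompA (adj1 v)) vv' -kcompA k2' h2'.
Qed.

End AdjointablePairs.

Theorem theorem5p2 (K : comPzRingType)
    (K_noeth : noetherian K) (K_csl : complete_semilocal K)
    (two_inv : exists u : K, (u * 2%:R = 1)%R)
    (C : kcategory K) (I : Type) (I_nonempty : inhabited I)
    (H : I -> hermitian_structure C)
    (H_klinear : forall i, klinear_structure (H i))
    (hom_fg : forall X Y : C, finitely_generated (setT : set (khom X Y)))
    (M M' M'' : sesq_system H) :
  isometric (orth_sum M M') (orth_sum M M'') <-> isometric M' M''.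
Proof.
split=> [/isometricP[f [g [af gf fg]]]|/isometricP[f [g [af gf fg]]]].
  pose A := orth_sum M M'; pose B := orth_sum M M''; pose S := orth_sum A B.
  (* If the identity of [S] vanishes, its retracts M' and M'' are zero objects and the zero map is
     an isometry; otherwise the algebra is nonzero. *)
  have [Q0|Q_nz] := pselect (kid (sys_ob S) = 0).
    have hom0 X Y i p (x : khom X Y) : kcomp p (kcomp (kid (sys_ob S)) i) = kid Y -> x = 0.
      by rewrite Q0 kcomp0l kcomp0r => Y0; rewrite -(kcomp_idl x) -Y0 kcomp0l.
    have M'0 X (x : khom X (sys_ob M')) : x = 0.
      apply: (hom0 _ _ (kcomp (kin1 _ _) (kin2 _ _)) (kcomp (kpr2 _ _) (kpr1 _ _))).
      by rewrite kcomp_idl -kcompA !ksumK.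
    have M''0 X (x : khom X (sys_ob M'')) : x = 0.
      apply: (hom0 _ _ (kcomp (kin2 _ _) (kin2 _ _)) (kcomp (kpr2 _ _) (kpr2 _ _))).
      by rewrite kcomp_idl -kcompA !ksumK.
    apply/isometricP; exists 0, 0; split; first exact: adjoint0.
      by rewrite [RHS]M'0 kcomp0l.
    by rewrite [RHS]M''0 kcomp0l.
  have inA := adjoint_in1 A B; have inB := adjoint_in2 A B.
  (* One copy of [M] lies in [A], the other in [B]; the given isometry, extended by zero to [S],
     carries [A] onto [B]. *)
  apply: (orthogonal_complement_cancel H_klinear Q_nz K_noeth K_csl two_inv (hom_fg _ _)
    (adjoint_comp (adjoint_in1 M M') inA) (adjoint_comp (adjoint_in2 M M') inA)
    (adjoint_comp (adjoint_in1 M M'') inB) (adjoint_comp (adjoint_in2 M M'') inB)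
    (adjoint_comp (adjoint_sym inA) (adjoint_comp af inB)));
    rewrite -!kcompA !ksumK //.
  - by rewrite (kcompA g) gf kcomp_idl -kcompDr !(kcompA _ _ (kpr1 _ _)) -kcompDl
      ksum_id kcomp_idl.
  - by rewrite (kcompA f) fg kcomp_idl -kcompDr !(kcompA _ _ (kpr2 _ _)) -kcompDl
      ksum_id kcomp_idl.
(* Conversely, the isometry is the sum of the identity of [M] and [f]. *)
apply/isometricP.
exists (kcomp (kin1 _ _) (kpr1 _ _) + kcomp (kcomp (kin2 _ _) f) (kpr2 _ _)).
exists (kcomp (kin1 _ _) (kpr1 _ _) + kcomp (kin2 _ _) (kcomp g (kpr2 _ _))).
split.
- apply: adjointD.
    exact: adjoint_comp (adjoint_sym (adjoint_in1 M M')) (adjoint_in1 M M'').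
  exact: adjoint_comp (adjoint_sym (adjoint_in2 M M'))
    (adjoint_comp af (adjoint_in2 M M'')).
- rewrite kcompDl !kcompDr -!kcompA !ksumK !kcomp0r addr0 add0r.
  by rewrite (kcompA g) gf kcomp_idl ksum_id.
- rewrite kcompDl !kcompDr -!kcompA !ksumK !kcomp0r addr0 add0r.
  by rewrite (kcompA f) fg kcomp_idl ksum_id.
Qed.
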